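(* (1) For every set partition $\pi$, $\omega(\mathbf q_\pi)=\mathbf q_\pi$. (2) The set $\{\mathbf q_\pi:\pi\text{ a set partition all of whose blocks have odd size}\}$ is a linear basis of $\mathrm{NC}\Omega$. (3) As an algebra, $\mathrm{NC}\Omega$ is freely generated by $\{\mathbf p_\pi:\pi\text{ a connected set partition with all blocks of odd size}\}$, and also freely generated by $\{\mathbf q_\pi:\pi\text{ a connected set partition with all blocks of odd size}\}$.
   Context: Let $\mathbf x_1,\mathbf x_2,\dots$ be noncommuting variables over $\mathbb Q$, $[m]=\{1,\dots,m\}$. For a set partition $\pi$ of $[n]$ with blocks $\pi_1,\dots,\pi_{\ell(\pi)}$: $\mathbf m_\pi=\sum\mathbf x_{i_1}\cdots\mathbf x_{i_n}$ over tuples of positive integers with $i_j=i_k$ iff $j,k$ lie in the same block; $\mathbf p_\pi$ the same sum over tuples with $i_j=i_k$ whenever $j,k$ lie in the same block; $\mathbf e_\pi$ over tuples with $i_j\ne i_k$ whenever $j\ne k$ lie in the same block; $\mathbf h_\pi=\sum c\,\mathbf x_{i_1}\cdots\mathbf x_{i_n}$ with $c=\prod_{b,v}(\#\{j\in\pi_b:i_j=v\})!$. $\mathrm{NCSym}=\mathrm{span}\{\mathbf m_\pi\}$, and $\omega$ is the linear involution of $\mathrm{NCSym}$ with $\omega(\mathbf h_\pi)=\mathbf e_\pi$. For a set composition $\phi$ of $[n]$, $\mathbf M_\phi=\sum\mathbf x_{i_1}\cdots\mathbf x_{i_n}$ over tuples with $i_j=i_k$ iff $j,k$ are in the same block of $\phi$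 and $i_j<i_k$ iff the block of $j$ is left of that of $k$; $\mathrm{NCQSym}=\mathrm{span}\{\mathbf M_\phi\}\supseteq\mathrm{NCSym}$. For $A\subseteq[n-1]$, $\sigma\in\mathfrak S_n$, $\mathbf F_{(A,\sigma)}=\sum_f\mathbf x_{f(\sigma^{-1}(1))}\cdots\mathbf x_{f(\sigma^{-1}(n))}$ over weakly increasing $f:[n]\to\{1,2,\dots\}$ with $f(i)<f(i+1)$ for $i\in A$; those with $\{i:\sigma(i)>\sigma(i+1)\}\subseteq A$ form a basis of $\mathrm{NCQSym}$. Order nonzero integers by $-1\prec1\prec-2\prec2\prec\cdots$; for $\gamma,\sigma\in\mathfrak S_n$, $\mathbf K_{(\gamma,\sigma)}=\sum_f\mathbf x_{|f(\sigma^{-1}(1))|}\cdots\mathbf x_{|f(\sigma^{-1}(n))|}$ over $f:[n]\to\mathbb Z\setminus\{0\}$, $f(1)\preceq\cdots\preceq f(n)$, with $f(i)=f(i+1)>0\Rightarrow\gamma(i)<\gamma(i+1)$ and $f(i)=f(i+1)<0\Rightarrow\gamma(i)>\gamma(i+1)$; it depends only on $\{i:\gamma(i-1)<\gamma(i)>\gamma(i+1)\}$ and $\sigma$, giving $\mathbf K_{(B,\sigma)}$ for peak sets $B$. $\Theta_{\mathrm{NCQSym}}$ is the linear map with $\mathbf F_{(A,\sigma)}\mapsto\mathbf K_{(A\setminus((A+1)\cup\{1\}),\sigma)}$ for $\{i:\sigma(i)>\sigma(i+1)\}\subseteq A$. $\mathrm{NC}\Omega=\Theta_{\mathrm{NCQSym}}(\mathrm{NCSym})$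 and $\mathbf q_\pi=\Theta_{\mathrm{NCQSym}}(\mathbf h_\pi)$. A set partition $\pi$ of $[n]$ ($n\ge1$) is connected if there is no $0<m<n$ such that every block of $\pi$ is contained in $[m]$ or in $[n]\setminus[m]$. *)

(* Defs.v *)
From mathcomp Require Import all_boot all_order all_algebra all_fingroup.
From mathcomp Require Import all_classical.

Set Implicit Arguments.
Unset Strict Implicit.
Unset Printing Implicit Defensive.

Import Order.TTheory GRing.Theory Num.Theory.

Local Open Scope ring_scope.

(* Formal series over Q in noncommuting variables x_1, x_2, ..., given by their
   coefficients on words.  The letter k : nat of a word stands for x_(k+1), so
   that nat is in bijection with the positive integers.  Beware that the
   product of the library on this function type is pointwise; the product of
   series is [ncmul] below. *)
Notation ncseries := (seq nat -> rat^o).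

Definition ncone : ncseries := fun w => (w == [::])%:R.

Definition ncmul (f g : ncseries) : ncseries :=
  fun w => \sum_(k < (size w).+1) f (take k w) * g (drop k w).

Section LinearAlgebra.

Definition subspace (S : set ncseries) : Prop :=
  S 0 /\ forall (a : rat) u v, S u -> S v -> S (a *: u + v).

Definition subalgebra (S : set ncseries) : Prop :=
  [/\ subspace S, S ncone & forall u v, S u -> S v -> S (ncmul u v)].

Definition lspan (X : set ncseries) : set ncseries := smallest subspace X.

Definition alg_gen (X : set ncseries) : set ncseries := smallest subalgebra X.

Definition linear_on (W : set ncseries) (T : ncseries -> ncseries) : Prop :=
  forall (a : rat) u v, W u -> W v -> T (a *: u + v) = a *: T u + T v.

Variables (I : eqType) (D : pred I) (b : I -> ncseries) (W : set ncseries).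

Definition lin_indep : Prop :=
  forall (s : seq I) (c : I -> rat), uniq s -> all D s ->
  \sum_(i <- s) c i *: b i = 0 -> forall i, i \in s -> c i = 0.

Definition linear_basis : Prop := lin_indep /\ W = lspan [set b i | i in D]%classic.

End LinearAlgebra.

Definition ncmonomial (I : eqType) (b : I -> ncseries) (s : seq I) : ncseries :=
  foldr (fun i f => ncmul (b i) f) ncone s.

(* The family (b i) for i in D generates the unital algebra W and satisfies no
   nontrivial noncommutative polynomial relation. *)
Definition freely_generates (I : eqType) (D : pred I) (b : I -> ncseries)
    (W : set ncseries) : Prop :=
  W = alg_gen [set b i | i in D]%classic /\ lin_indep (all D) (ncmonomial b).

(* The sum of c(i_1, ..., i_n) x_(i_1) ... x_(i_n) over all tuples
   (i_1, ..., i_n) of letters. *)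
Definition tuplesum n (c : ('I_n -> nat) -> rat) : ncseries :=
  fun w => if size w == n then c (fun j : 'I_n => nth 0%N w j) else 0.

(* Elements of [n] are coded by 'I_n, the ordinal i standing for i+1. *)
Definition setpart n := {P : {set {set 'I_n}} | finset.partition P [set: 'I_n]}.

Definition anypart := {n : nat & setpart n}.

Section Partitions.
Variables (n : nat) (pi : setpart n).
Implicit Type i : 'I_n -> nat.

Definition same_block (j k : 'I_n) : bool := k \in finset.pblock (val pi) j.

Definition m_ : ncseries := tuplesum (fun i =>
  ([forall j, forall k, (i j == i k) == same_block j k])%:R).

Definition p_ : ncseries := tuplesum (fun i =>
  ([forall j, forall k, same_block j k ==> (i j == i k)])%:R).

Definition e_ : ncseries := tuplesum (fun i =>
  ([forall j, forall k, same_block j k && (j != k) ==> (i j != i k)])%:R).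

(* The values v that do not occur in the tuple contribute the factor 0! = 1. *)
Definition h_ : ncseries := tuplesum (fun i =>
  (\prod_(B in val pi) \prod_(v <- undup (codom i))
     (#|[set j in B | i j == v]|)`!)%:R).

Definition odd_blocks : bool := [forall B in val pi, odd #|B|].

Definition connected : bool :=
  (0 < n)%N &&
  [forall m : 'I_n, (0 < m)%N ==>
     ~~ [forall B in val pi, (B \subset [set j : 'I_n | (j < m)%N])
                          || (B \subset [set j : 'I_n | (m <= j)%N])]].

End Partitions.

Definition NCSym : set ncseries :=
  lspan [set f | exists n (pi : setpart n), f = m_ pi]%classic.

Definition is_omega (T : ncseries -> ncseries) : Prop :=
  [/\ linear_on NCSym T,
      (forall f, NCSym f -> NCSym (T f)),
      (forall f, NCSym f -> T (T f) = f) &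
      forall n (pi : setpart n), T (h_ pi) = e_ pi].

(* As the h_pi span NCSym, the values on NCSym are determined; those outside of
   NCSym are irrelevant. *)
Definition omega : ncseries -> ncseries := xget (fun f : ncseries => f) is_omega.

Definition is_setcomp n (phi : seq {set 'I_n}) : bool :=
  uniq phi && finset.partition [set B in phi] [set: 'I_n].

(* The index of the block of j, counted from the left. *)
Definition block_index n (phi : seq {set 'I_n}) (j : 'I_n) : nat :=
  find (fun B : {set 'I_n} => j \in B) phi.

Definition M_ n (phi : seq {set 'I_n}) : ncseries := tuplesum (fun i =>
  ([forall j, forall k,
      ((i j == i k) == (block_index phi j == block_index phi k)) &&
      ((i j < i k)%N == (block_index phi j < block_index phi k)%N)])%:R).

Definition NCQSym : set ncseries :=
  lspan [set f | exists n (phi : seq {set 'I_n}), is_setcomp phi /\ f = M_ phi]%classic.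

Section Descents.
Variable n : nat.
Implicit Types (A : {set 'I_n}) (g s : 'S_n).

(* [n-1] as a subset of [n]. *)
Definition interior_ord : {set 'I_n} := [set i : 'I_n | (i.+1 < n)%N].

Definition Des s : {set 'I_n} :=
  [set i : 'I_n | [exists j : 'I_n, (j == i.+1 :> nat) && (s j < s i)%N]].

Definition Peak g : {set 'I_n} :=
  [set i : 'I_n | [exists h : 'I_n, exists j : 'I_n,
     [&& i == h.+1 :> nat, j == i.+1 :> nat, (g h < g i)%N & (g j < g i)%N]]].

(* A \ ((A+1) U {1}). *)
Definition peaks_of_des A : {set 'I_n} :=
  A :\: ([set i : 'I_n | [exists h in A, i == h.+1 :> nat]]
         :|: [set i : 'I_n | i == 0%N :> nat]).

Definition F_admissible A (f : 'I_n -> nat) : bool :=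
  [forall i : 'I_n, forall j : 'I_n, (j == i.+1 :> nat) ==>
     (f i <= f j)%N && ((i \in A) ==> (f i < f j)%N)].

(* There is exactly one f with (f(s^-1(1)), ..., f(s^-1(n))) equal to a given
   tuple i, namely i o s. *)
Definition F_ A s : ncseries := tuplesum (fun i =>
  (F_admissible A (fun k => i (s k)))%:R).

(* The order -1 < 1 < -2 < 2 < ... on nonzero integers. *)
Definition prec_le (a b : int) : bool :=
  (`|a| < `|b|) || ((`|a| == `|b|) && (a <= b)).

Definition K_admissible g (f : 'I_n -> int) : bool :=
  [forall i : 'I_n, forall j : 'I_n, (j == i.+1 :> nat) ==>
     [&& prec_le (f i) (f j),
         (f i == f j) && (0 < f i) ==> (g i < g j)%N &
         (f i == f j) && (f i < 0) ==> (g j < g i)%N]].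

(* The f : [n] -> Z\{0} with (|f(s^-1(1))|, ..., |f(s^-1(n))|) equal to a given
   tuple i correspond to the choices of a sign for each value; the letter
   i (s k) denotes the positive integer (i (s k)).+1. *)
Definition K_ g s : ncseries := tuplesum (fun i =>
  #|[set eps : {ffun 'I_n -> bool} |
      K_admissible g (fun k => (-1) ^+ eps k * (i (s k)).+1%:Z)]|%:R).

(* K_(B,s), through any g with peak set B (the choice does not matter). *)
Definition K_peak (B : {set 'I_n}) s : ncseries :=
  if [pick g : 'S_n | Peak g == B] is Some g then K_ g s else 0.

End Descents.

Definition is_Theta (T : ncseries -> ncseries) : Prop :=
  linear_on NCQSym T /\
  forall n (A : {set 'I_n}) (s : 'S_n),
    A \subset interior_ord n -> Des s \subset A ->
    T (F_ A s) = K_peak (peaks_of_des A) s.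

(* Again only the values on NCQSym are determined and relevant. *)
Definition Theta : ncseries -> ncseries := xget (fun f : ncseries => f) is_Theta.

Definition NCOmega : set ncseries := [set Theta f | f in NCSym]%classic.

Definition q_ n (pi : setpart n) : ncseries := Theta (h_ pi).

(* Main.v *)
(* Both omega and Theta arise from evaluating a series on an enlarged alphabet.
   Replace every letter by N ordered copies of weight -1 followed by one copy of
   weight t, read off the coefficients, and extrapolate the result, a polynomial
   in N, to N = -1; call this linear operator Psi t.  On p_pi it acts as the
   scalar prod_B (t^|B| - (-1)^|B|).

   For t = 1 a transfer-matrix computation along the letters shows that Psi 1
   sends F_(A,sigma) to K with the peak set of A, so Psi 1 is Theta on NCQSym:
   p_pi goes to 2^l(pi) p_pi if all blocks are odd and to 0 otherwise.  For t = 0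
   the scalar is (-1)^(n - l(pi)), so Psi 0 is omega, and it fixes p_pi when all
   blocks are odd.  Hence NCOmega is the span of the p_pi with odd blocks, and
   omega is the identity on it.

   The h_pi expand nonnegatively in the p_sigma with sigma finer than pi, by
   counting recursive forests, so the q_pi with odd blocks are triangular in the
   p_pi with odd blocks.  Both families turn concatenation of set partitions into
   products, and a set partition is a concatenation of connected ones in exactly
   one way, which gives freeness. *)

Require Import Defs.
From mathcomp Require Import all_classical.
From mathcomp Require Import all_boot all_order all_algebra all_fingroup.
From mathcomp Require Import zify ring.

Set Implicit Arguments.
Unset Strict Implicit.
Unset Printing Implicit Defensive.

Import Order.TTheory GRing.Theory Num.Theory.
Local Open Scope ring_scope.

(** * Extrapolation of polynomial sequences *)

(** With N copies of weight -1 and one of weight t, the k-th power sum of the weights is N (-1)^k +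
    t^k. Setting N = -1 is what produces t^k - (-1)^k, a signed count of copies that no actual
    alphabet realises; hence the detour through values at N = 0, ..., n, which determine a
    polynomial of degree at most n. The order of the copies matters for F. Along equal letters, sums
    over copies of weight -1 iterate a discrete antiderivative. Continuing these to N = -1 exchanges
    strict and weak inequalities, as in combinatorial reciprocity, and this is exactly how negative
    values differ from positive ones in K. One linear formula on all series serves two unrelated
    families: it is evaluated on power sums block by block and on F neighbour by neighbour, so the
    two are never expanded in one another to compute values. Since [omega] and [Theta] are choices
    among maps with prescribed values, [Psi] also witnesses that such maps exist, and spanning
    families identify the choices with it on [NCSym]. *)

(* f is given by a polynomial of degree less than d. *)
Fixpoint lowdeg (d : nat) (f : nat -> rat) : Prop :=
  if d is d'.+1 then lowdeg d' (fun n => f n.+1 - f n) else forall n, f n = 0.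

Lemma lowdeg_ext d f g : f =1 g -> lowdeg d f -> lowdeg d g.
Proof.
elim: d f g => [|d IHd] f g fg /=; first by move=> f0 n; rewrite -fg.
by apply: IHd => n; rewrite !fg.
Qed.

Lemma lowdegD d f g : lowdeg d f -> lowdeg d g -> lowdeg d (fun n => f n + g n).
Proof.
elim: d f g => [|d IHd] f g /= hf hg; first by move=> n; rewrite hf hg addr0.
by apply: lowdeg_ext (IHd _ _ hf hg) => n; ring.
Qed.

Lemma lowdegS d f : lowdeg d f -> lowdeg d.+1 f.
Proof.
elim: d f => [|d IHd] f; last exact: IHd.
by move=> f0 n; rewrite !f0 subrr.
Qed.

Lemma lowdeg_leq d e f : (d <= e)%N -> lowdeg d f -> lowdeg e f.
Proof.
by move/subnK <-; elim: (e - d)%N => //= k IHk hf; apply: lowdegS (IHk hf).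
Qed.

Lemma lowdeg_shift d f : lowdeg d f -> lowdeg d (fun n => f n.+1).
Proof.
elim: d f => [|d IHd] f /= hf; first by move=> n.
exact: IHd hf.
Qed.

Lemma lowdegN d f : lowdeg d f -> lowdeg d (fun n => - f n).
Proof.
elim: d f => [|d IHd] f /= hf; first by move=> n; rewrite hf oppr0.
by apply: lowdeg_ext (IHd _ hf) => n; ring.
Qed.

Lemma lowdeg_cst c : lowdeg 1 (fun=> c).
Proof. by move=> n; rewrite subrr. Qed.

Lemma lowdeg0 d : lowdeg d (fun=> 0).
Proof. exact: (@lowdeg_leq 0). Qed.

(** Discrete Leibniz rule: the difference of f g at n is df(n) g(n+1) + f(n) dg(n), and both
    summands have smaller total degree. *)
Lemma lowdegM a b f g :
  lowdeg a.+1 f -> lowdeg b.+1 g -> lowdeg (a + b).+1 (fun n => f n * g n).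
Proof.
have [m] := ubnP (a + b)%N.
elim: m a b f g => // m IHm a b f g; rewrite ltnS => leab hf hg /=.
pose df n := f n.+1 - f n; pose dg n := g n.+1 - g n.
apply: (@lowdeg_ext _ (fun n => df n * g n.+1 + f n * dg n)) => [n|].
  by rewrite /df /dg; ring.
have Hl : lowdeg (a + b) (fun n => df n * g n.+1).
  case: a leab hf => [|a] leab hf; last first.
    have lt_ab : (a + b < m)%N by lia.
    exact: (IHm _ _ _ _ lt_ab hf (lowdeg_shift hg)).
  apply: (@lowdeg_ext _ (fun=> 0)); last exact: lowdeg0.
  by move=> n; rewrite /df hf mul0r.
have Hr : lowdeg (a + b) (fun n => f n * dg n).
  case: b leab hg {Hl} => [|b] leab hg; last first.
    have lt_ab : (a + b < m)%N by lia.
    by rewrite addnS; exact: (IHm _ _ _ _ lt_ab hf hg).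
  apply: (@lowdeg_ext _ (fun=> 0)); last exact: lowdeg0.
  by move=> n; rewrite /dg hg mulr0.
exact: lowdegD Hl Hr.
Qed.

Lemma lowdeg_prod (I : eqType) (s : seq I) (f : I -> nat -> rat) :
  (forall i, lowdeg 2 (f i)) ->
  lowdeg (size s).+1 (fun n => \prod_(i <- s) f i n).
Proof.
move=> hf; elim: s => [|i s IHs].
  by apply: (@lowdeg_ext _ (fun=> 1)) (lowdeg_cst 1) => n; rewrite big_nil.
apply: (@lowdeg_ext _ (fun n => f i n * \prod_(j <- s) f j n)).
  by move=> n; rewrite big_cons.
exact: (lowdegM (hf i) IHs).
Qed.

(** Up to sign this is the n-th difference of f at 0. Pascal's rule reduces order n + 1 for f to
    order n for its difference. *)
Lemma lowdeg_alt_sum n f : lowdeg n f ->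
  \sum_(j < n.+1) (-1) ^+ j * 'C(n, j)%:R * f j = 0.
Proof.
elim: n f => [|n IHn] f hf.
  by rewrite big_ord_recl big_ord0 hf mulr0 addr0.
pose F j := (-1) ^+ j * 'C(n, j)%:R * f j.
pose G j := (-1) ^+ j * 'C(n, j)%:R * f j.+1.
have E : \sum_(j < n.+1) F j = \sum_(j < n.+1) G j.
  apply/eqP; rewrite -subr_eq0 -sumrB -oppr_eq0 -sumrN; apply/eqP.
  rewrite -[RHS](IHn _ hf); apply: eq_bigr => j _.
  by rewrite /F /G; ring.
have -> : \sum_(j < n.+2) (-1) ^+ j * 'C(n.+1, j)%:R * f j
    = \sum_(j < n.+2) F j - \sum_(j < n.+1) G j.
  rewrite big_ord_recl [in RHS]big_ord_recl /F /= !bin0 -addrA -sumrB.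
  congr (_ + _); apply: eq_bigr => j _.
  by rewrite /bump /= add1n binS natrD exprS /G; ring.
by rewrite big_ord_recr /= E /F bin_small // mulr0 mul0r addr0 subrr.
Qed.

(* With f indexed so that f m is the value at m - 1, this recovers the value at
   N = -1 from those at N = 0, ..., n. *)
Definition extrap_coef (n N : nat) : rat := (-1) ^+ N * 'C(n.+1, N.+1)%:R.

(** The vanishing alternating sum of order n + 1 is solved for its term at index 0. *)
Lemma extrapolate n f : lowdeg n.+1 f ->
  \sum_(N < n.+1) extrap_coef n N * f N.+1 = f 0%N.
Proof.
move/lowdeg_alt_sum; rewrite big_ord_recl /= bin0 expr0 !mul1r.
under eq_bigr do rewrite /bump /= add1n exprS mulN1r !mulNr.
by rewrite sumrN => /eqP; rewrite subr_eq0 => /eqP->.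
Qed.

(* With the same index shift, the sum of the values of u at 0, ..., m - 2,
   continued by - u 0 at m = 0. *)
Definition antidiff (u : nat -> rat) (m : nat) : rat := \sum_(k < m) u k - u 0%N.

Lemma lowdeg_antidiff d u : lowdeg d u -> lowdeg d.+1 (antidiff u).
Proof.
by apply: lowdeg_ext => n; rewrite /antidiff big_ord_recr /=; ring.
Qed.

(** * The operators Psi t *)

Definition copy_sign (t : rat) N (x : 'I_N.+1) : rat := if (x < N)%N then -1 else t.

(** Copy c of the letter i becomes i (N + 1) + c, so the enlarged alphabet is ordered by letter
    first and by copy second. *)
Definition blow_up (w : seq nat) N (c : {ffun 'I_(size w) -> 'I_N.+1}) : seq nat :=
  [seq (nth 0%N w j * N.+1 + c j)%N | j : 'I_(size w) <- enum 'I_(size w)].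

(** The formula makes sense for every f; that the inner sum is a polynomial in N of degree at most
    the length of the word is established for [p_] and for [F_]. *)
Definition Psi (t : rat) (f : ncseries) : ncseries := fun w =>
  \sum_(N < (size w).+1) extrap_coef (size w) N *
    \sum_(c : {ffun 'I_(size w) -> 'I_N.+1})
       (\prod_j copy_sign t (c j)) * f (blow_up c).

Lemma Psi_linear t a f g : Psi t (a *: f + g) = a *: Psi t f + Psi t g.
Proof.
apply/funext => w; rewrite /Psi /=.
under eq_bigr => N _.
  under eq_bigr do rewrite /= mulrDr.
  rewrite big_split /= mulrDr.
  have -> (c : {ffun 'I_(size w) -> 'I_N.+1} -> rat) :
    \sum_i c i * (a *: f) (blow_up i) = a * \sum_i c i * f (blow_up i).
    by rewrite mulr_sumr; apply: eq_bigr => i _; rewrite mulrCA.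
  rewrite mulrCA; over.
by rewrite big_split /= -mulr_sumr.
Qed.

Lemma tuplesum_ext n (c d : ('I_n -> nat) -> rat) : c =1 d -> tuplesum c = tuplesum d.
Proof. by move=> cd; apply/funext => w; rewrite /tuplesum cd. Qed.

Lemma Psi_tuplesum t n (phi : ('I_n -> nat) -> rat) :
  Psi t (tuplesum phi) = tuplesum (fun i =>
    \sum_(N < n.+1) extrap_coef n N * \sum_(c : {ffun 'I_n -> 'I_N.+1})
       (\prod_j copy_sign t (c j)) * phi (fun j => i j * N.+1 + c j)%N).
Proof.
apply/funext => w; rewrite /Psi /tuplesum.
case: eqP => [E|/eqP ne]; last first.
  rewrite big1 // => N _; rewrite big1 ?mulr0 // => c _.
  by rewrite size_map size_enum_ord (negPf ne) mulr0.
case: n / E phi => phi; apply: eq_bigr => N _; congr (_ * _).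
apply: eq_bigr => c _; rewrite size_map size_enum_ord eqxx; congr (_ * phi _).
apply/funext => j.
by rewrite (nth_map j) ?size_enum_ord // nth_ord_enum.
Qed.

(** * Transfer-matrix evaluation of sums over words *)

Section ChainSums.
Variables (S : finType) (wt : S -> rat).

(** Weighted number of words of length n that may follow the letter x; [adj k] governs the step into
    position k, so the rule may vary along the word. *)
Fixpoint chain (adj : nat -> rel S) n k x : rat :=
  if n is n'.+1 then \sum_y (adj k x y)%:R * wt y * chain adj n' k.+1 y else 1.

Definition ffun_cons n (p : S * {ffun 'I_n -> S}) : {ffun 'I_n.+1 -> S} :=
  [ffun i => oapp p.2 p.1 (unlift ord0 i)].

Lemma ffun_cons_bij n : bijective (@ffun_cons n).
Proof.
exists (fun f : {ffun 'I_n.+1 -> S} =>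
  (f ord0, [ffun j : 'I_n => f (lift ord0 j)])) => [[x f]|f].
  rewrite ffunE unlift_none /=; congr (_, _).
  by apply/ffunP => j; rewrite !ffunE liftK.
apply/ffunP => i; rewrite ffunE.
by case: unliftP => [j|] -> //=; rewrite ffunE.
Qed.

Definition chained (adj : nat -> rel S) n k (c : {ffun 'I_n -> S}) :=
  [forall i : 'I_n, forall j : 'I_n,
     (j == i.+1 :> nat) ==> adj (k + j)%N (c i) (c j)].

Definition started (adj : nat -> rel S) n k x (c : {ffun 'I_n -> S}) :=
  [forall j : 'I_n, (j == 0 :> nat) ==> adj k x (c j)] && chained adj k c.

Lemma chained_cons adj n k x (c : {ffun 'I_n -> S}) :
  chained adj k (ffun_cons (x, c)) = started adj k.+1 x c.
Proof.
apply/forallP/andP => [H|[/forallP H0 /forallP H]].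
  split; apply/forallP => i.
    apply/implyP => /eqP i0; have /forallP/(_ (lift ord0 i))/implyP := H ord0.
    by rewrite !ffunE unlift_none liftK /= /bump /= i0 addn1; apply.
  apply/forallP => j; apply/implyP => ij.
  have /forallP/(_ (lift ord0 j))/implyP := H (lift ord0 i).
  by rewrite !ffunE !liftK /= /bump /= !add1n addnS addSn eqSS; apply.
move=> i; apply/forallP => j; apply/implyP.
case: (unliftP ord0 i) => [i'|] ->; case: (unliftP ord0 j) => [j'|] -> //=.
  rewrite /bump /= !add1n eqSS addnS -addSn !ffunE !liftK /= => ij.
  by move/forallP/(_ j')/implyP: (H i'); apply.
rewrite /bump /= add1n eqSS => j0.
rewrite !ffunE unlift_none liftK /= (eqP j0) addn1.
exact: implyP (H0 j') j0.
Qed.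

Lemma sum_ffun_cons n (G : {ffun 'I_n.+1 -> S} -> rat) :
  \sum_c G c = \sum_x \sum_(c : {ffun 'I_n -> S}) G (ffun_cons (x, c)).
Proof.
rewrite (reindex (@ffun_cons n)); last exact/onW_bij/ffun_cons_bij.
rewrite -(pair_bigA _ (fun x c => G (ffun_cons (x, c)))) /=.
by [].
Qed.

Lemma prod_ffun_cons n x (c : {ffun 'I_n -> S}) :
  \prod_j wt (ffun_cons (x, c) j) = wt x * \prod_j wt (c j).
Proof.
rewrite big_ord_recl ffunE unlift_none /=; congr (_ * _).
by apply: eq_bigr => j _; rewrite ffunE liftK.
Qed.

Lemma chain_started adj n k x :
  \sum_(c : {ffun 'I_n -> S}) (\prod_j wt (c j)) * (started adj k x c)%:R
  = chain adj n k x.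
Proof.
elim: n k x => [|n IHn] k x /=.
  under eq_bigr => c _.
    rewrite big_ord0 mul1r /started (_ : _ && _ = true); first over.
    by apply/andP; split; apply/forallP => -[].
  by rewrite sumr_const card_ffun card_ord expn0.
rewrite sum_ffun_cons; apply: eq_bigr => y _.
rewrite -IHn mulr_sumr; apply: eq_bigr => c _.
rewrite prod_ffun_cons /started chained_cons.
have -> : [forall j : 'I_n.+1, (j == 0 :> nat) ==> adj k x (ffun_cons (y, c) j)]
  = adj k x y.
  apply/forallP/idP => [/(_ ord0)|H j]; first by rewrite ffunE unlift_none.
  by apply/implyP => /eqP j0; rewrite (_ : j = ord0) ?ffunE ?unlift_none //; apply: val_inj.
by rewrite -mulnb natrM; ring.
Qed.

Lemma chain_sum adj n k :
  \sum_(c : {ffun 'I_n.+1 -> S}) (\prod_j wt (c j)) * (chained adj k c)%:R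
  = \sum_x wt x * chain adj n k.+1 x.
Proof.
rewrite sum_ffun_cons; apply: eq_bigr => x _.
rewrite -chain_started mulr_sumr; apply: eq_bigr => c _.
by rewrite prod_ffun_cons chained_cons mulrA.
Qed.

End ChainSums.

(** * From fundamental to peak functions *)

Section FundamentalToPeak.
Variables (y : nat -> nat).
Implicit Types D : pred nat.

(* The admissibility conditions of F and K between the positions j - 1 and j. *)
Definition adjF D N j (x x' : 'I_N.+1) : bool :=
  (y j.-1 * N.+1 + x <= y j * N.+1 + x')%N &&
  (D j.-1 ==> (y j.-1 * N.+1 + x < y j * N.+1 + x')%N).

(** [true] is the negative sign and D marks the descents of g. Among equal letters a negative one
    may precede a positive one, or a negative one across a descent; a positive one precedes only a
    positive one, across an ascent. *)
Definition adjK D j (e e' : bool) : bool :=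
  (y j.-1 < y j)%N ||
  (y j.-1 == y j) && (if e then D j.-1 || ~~ e' else ~~ e' && ~~ D j.-1).

(** When the letter increases every copy is allowed; the tautology [N < x' + N.+1] states this in
    the form that [sum_copies] expects, with m = N + 1. *)
Lemma adjFE D N j (x x' : 'I_N.+1) : adjF D j x x' =
  if (y j.-1 < y j)%N then (N < x' + N.+1)%N
  else if y j.-1 == y j then (if D j.-1 then (x < x')%N else (x <= x')%N)
  else false.
Proof.
rewrite /adjF; have [hx hx'] := (ltn_ord x, ltn_ord x').
case: (ltngtP (y j.-1) (y j)) => [lt_y|lt_y|->].
- rewrite addnS ltnS leq_addl.
  have : (y j.-1 * N.+1 + x < y j * N.+1 + x')%N by nia.
  by move=> H; rewrite H (ltnW H) implybT.
- by apply/negbTE; rewrite negb_and -ltnNge; apply/orP; left; nia.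
- rewrite leq_add2l ltn_add2l; case: (D j.-1) => //=; last by rewrite andbT.
  by case: ltngtP.
Qed.

(** The m topmost copies consist of the one of weight 1, which gives p, and m - 1 of weight -1 at
    distances 1, ..., m - 1 from the top, whose values of u add up to [antidiff u m]. *)
Lemma sum_copies (u : nat -> rat) p r N m : (0 < m <= N.+1)%N ->
  \sum_(x : 'I_N.+1) (N < x + m)%:R * copy_sign 1 x *
     (if (x < N)%N then u (N - x)%N * r else p * r) = (p - antidiff u m) * r.
Proof.
case: m => // m /= hm.
rewrite big_ord_recr /= ltnn /copy_sign ltnn addnS ltnS leq_addr !mul1r mulrBl addrC.
congr (_ + _); rewrite (reindex_inj rev_ord_inj) /=.
rewrite /antidiff big_ord_recl /= addrC addKr mulr_suml -sumrN.
rewrite (big_ord_widen N (fun k => - (u k.+1 * r))) // [RHS]big_mkcond /=.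
apply: eq_bigr => k _; have hk := ltn_ord k.
have -> : (N - k.+1 < N)%N by lia.
have -> : (N - (N - k.+1) = k.+1)%N by lia.
have -> : (N < N - k.+1 + m.+1)%N = (k < m)%N by lia.
by case: (k < m)%N; rewrite ?mul0r // !mul1r mulN1r.
Qed.

(* [u], as a function of the number of smaller copies still available, and [R],
   as a function of the number N of copies, are both given by polynomials;
   index 0 stands for the argument -1 in either case. *)
Lemma chain_polynomial D n k : exists a b (u R : nat -> rat) (p : rat),
  [/\ (a + b <= n)%N, lowdeg a.+1 u, lowdeg b.+1 R,
      forall N (x : 'I_N.+1), chain (@copy_sign 1 N) (@adjF D N) n k x =
        if (x < N)%N then u (N - x)%N * R N.+1 else p * R N.+1 &
      forall e, chain (fun=> 1) (adjK D) n k e = (if e then u 0%N else p) * R 0%N].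
Proof.
elim: n k => [|n IHn] k.
  exists 0%N, 0%N, (fun=> 1), (fun=> 1), 1.
  split=> //.
  - by move=> N x; rewrite !mulr1 if_same.
  - by move=> e; rewrite !mulr1 if_same.
have [a [b [u [R [p [leab hu hR hF hK]]]]]] := IHn k.+1.
(* The contribution of the m topmost copies, up to the factor R. At m = 0 it is p + u 0, the sum
   over both signs, and at m = 1 it is p, the positive sign alone: these are the cases that [adjK]
   distinguishes. *)
pose U m := p - antidiff u m.
have hU : lowdeg a.+2 U.
  apply: lowdegD; first exact: lowdeg_leq (lowdeg_cst p).
  exact: lowdegN (lowdeg_antidiff hu).
have U0 : U 0%N = p + u 0%N by rewrite /U /antidiff big_ord0 sub0r opprK.
have U1 : U 1%N = p.
  by rewrite /U /antidiff big_ord_recl big_ord0 addr0 subrr subr0.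
have step N (x : 'I_N.+1) : chain (@copy_sign 1 N) (@adjF D N) n.+1 k x =
    \sum_(x' : 'I_N.+1) (adjF D k x x')%:R * copy_sign 1 x' *
       (if (x' < N)%N then u (N - x')%N * R N.+1 else p * R N.+1).
  by rewrite /=; apply: eq_bigr => x' _; rewrite hF.
have stepK e : chain (fun=> 1) (adjK D) n.+1 k e =
    ((adjK D k e true)%:R * u 0%N + (adjK D k e false)%:R * p) * R 0%N.
  by rewrite /= big_bool /= !mulr1 !hK; ring.
case: (ltngtP (y k.-1) (y k)) => [lt_y|gt_y|eq_y].
(* All N + 1 copies may follow, so the result does not depend on x and the factor U is absorbed into
   R. *)
- exists 0%N, (a.+1 + b)%N, (fun=> 1), (fun m => U m * R m), 1; split.
  + by rewrite add0n addSn ltnS.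
  + exact: lowdeg_cst.
  + exact: lowdegM hU hR.
  + move=> N x; rewrite !mul1r if_same step -(@sum_copies u p _ N) ?leqnn //.
    by apply: eq_bigr => x' _; rewrite adjFE lt_y.
  + by move=> e; rewrite stepK /adjK lt_y /= U0 if_same; ring.
- exists 0%N, 0%N, (fun=> 0), (fun=> 0), 0; split=> //.
  + move=> N x; rewrite mulr0 if_same step big1 // => x' _.
    by rewrite adjFE ltnNge (ltnW gt_y) /= gtn_eqF // !mul0r.
  + by move=> e; rewrite stepK /adjK ltnNge (ltnW gt_y) /= gtn_eqF //=; ring.
have y_lt : (y k.-1 < y k)%N = false by rewrite eq_y ltnn.
case hD : (D k.-1).
(* A strict increase leaves the N - x copies above x, and none at all above the last copy, hence p =
   0. *)
- exists a.+1, b, U, R, 0; split=> //.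
  + move=> N x; rewrite step; have hx := ltn_ord x.
    under eq_bigr do rewrite adjFE y_lt eq_y eqxx hD.
    case: ltnP => [lt_x|ge_x]; last first.
      rewrite mul0r big1 // => x' _.
      by rewrite ltnNge (leq_trans _ ge_x) ?mul0r //; have := ltn_ord x'; lia.
    rewrite -(@sum_copies u p _ N); last by lia.
    apply: eq_bigr => x' _; congr (_%:R * _ * _); lia.
  + by move=> e; rewrite stepK /adjK y_lt eq_y eqxx hD /= U0; case: e => /=; ring.
(* A weak increase also allows x itself, which shifts the argument of U by one; at the last copy
   this leaves U 1 = p. *)
- exists a.+1, b, (fun m => U m.+1), R, p; split=> //.
  + exact: lowdeg_shift.
  + move=> N x; rewrite step; have hx := ltn_ord x.
    under eq_bigr do rewrite adjFE y_lt eq_y eqxx hD.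
    have -> : (if (x < N)%N then U (N - x).+1 * R N.+1 else p * R N.+1)
            = U (N - x).+1 * R N.+1.
      case: ltnP => // ge_x.
      have -> : (N - x)%N = 0%N by lia.
      by rewrite U1.
    rewrite -(@sum_copies u p _ N); last by lia.
    apply: eq_bigr => x' _; congr (_%:R * _ * _); lia.
  + by move=> e; rewrite stepK /adjK y_lt eq_y eqxx hD /= U1; case: e => /=; ring.
Qed.

(** The first letter is unconstrained, like a letter after an increase: the sum over its copies is a
    polynomial in N of degree at most n + 1, whose value at N = -1 is the sum over the signs. *)
Lemma extrapolate_chain D n :
  \sum_(N < n.+2) extrap_coef n.+1 N *
     \sum_(x : 'I_N.+1) copy_sign 1 x * chain (@copy_sign 1 N) (@adjF D N) n 1 x
  = \sum_(e : bool) 1 * chain (fun=> 1) (adjK D) n 1 e.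
Proof.
have [a [b [u [R [p [leab hu hR hF hK]]]]]] := chain_polynomial D n 1.
pose f m := (p - antidiff u m) * R m.
have hf : lowdeg n.+2 f.
  apply: (@lowdeg_leq (a.+1 + b).+1); first by lia.
  apply: lowdegM hR; apply: lowdegD; first exact: lowdeg_leq (lowdeg_cst p).
  exact: lowdegN (lowdeg_antidiff hu).
have <- : f 0%N = \sum_(e : bool) 1 * chain (fun=> 1) (adjK D) n 1 e.
  by rewrite big_bool /= !hK /f /antidiff big_ord0; ring.
rewrite -(extrapolate hf); apply: eq_bigr => N _; congr (_ * _).
rewrite /f -(@sum_copies u p _ N) ?leqnn //; apply: eq_bigr => x _.
by rewrite hF addnS ltnS leq_addl mul1r.
Qed.

(** A product over the runs of equal letters, each giving 2, or 0 if P holds strictly inside the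
    run. The test [0 < n'] excludes the last position, whose successor is outside the word. *)
Fixpoint peak_chain (P : pred nat) n k : rat :=
  if n is n'.+1 then
    if (y k.-1 < y k)%N then 2%:R * peak_chain P n' k.+1
    else if y k.-1 == y k then
      (if [&& (0 < n')%N, y k == y k.+1 & P k] then 0 else peak_chain P n' k.+1)
    else 0
  else 2%:R.

(* A run of equal letters admits two sign patterns if it has no interior peak and
   none otherwise; this is why K depends on g only through its peaks. *)
Lemma chain_peaks D P n k :
  (forall j, (k <= j)%N -> (j.+1 < k + n)%N -> P j = D j && ~~ D j.-1) ->
  chain (fun=> 1) (adjK D) n k true + chain (fun=> 1) (adjK D) n k false
    = peak_chain P n k /\
  2%:R * chain (fun=> 1) (adjK D) n k false =
    if [&& (0 < n)%N, y k.-1 == y k & D k.-1] then 0 else peak_chain P n k.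
Proof.
(* Within a run the position before a descent must be negative and the one after an ascent positive.
   A peak would have to be both; without a peak only the valley is free. The second equation, for a
   positive start, is the extra information that the induction needs. *)
elim: n k => [|n IHn] k hP /=; first by split; rewrite ?mulr1.
have [|IH1 IH2] := IHn k.+1; first by move=> j *; apply: hP; lia.
rewrite /= in IH2.
rewrite !big_bool /= !mulr1 /adjK.
case: (ltngtP (y k.-1) (y k)) => [lt_y|gt_y|eq_y] /=.
- by rewrite -IH1; split; ring.
- by split; ring.
case: n IHn hP IH1 IH2 => [|n] IHn hP IH1 IH2.
  by rewrite /= ?if_same; case: (D k.-1) => /=; split; ring.
have PE : P k = D k && ~~ D k.-1 by apply: hP; lia.
rewrite PE; move: IH1 IH2; case: (D k.-1) => /=.
  rewrite !andbF /= => <- _; split; ring.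
rewrite andbT => IH1 <-; split; ring.
Qed.

End FundamentalToPeak.

Definition desF n (A : {set 'I_n.+1}) : pred nat := fun k => inord k \in A.

(** [F_] tests a tuple in the order given by s. Reindexing the copies by s makes the inner sum a
    chain sum along the rearranged letters i (s k). *)
Lemma Psi_F n (A : {set 'I_n.+1}) (s : 'S_n.+1) :
  Psi 1 (F_ A s) = tuplesum (fun i =>
    \sum_(e : bool) 1 * chain (fun=> 1) (adjK (fun k => i (s (inord k))) (desF A)) n 1 e).
Proof.
rewrite /F_ Psi_tuplesum; apply: tuplesum_ext => i.
rewrite -extrapolate_chain; apply: eq_bigr => N _; congr (_ * _).
rewrite -(chain_sum (@copy_sign 1 N) _ n 0).
pose h (c : {ffun 'I_n.+1 -> 'I_N.+1}) : {ffun 'I_n.+1 -> 'I_N.+1} :=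
  [ffun j => c (s^-1%g j)].
rewrite (reindex h); last first.
  exists (fun c : {ffun 'I_n.+1 -> 'I_N.+1} => [ffun j => c (s j)]) => c _;
    by apply/ffunP => j; rewrite !ffunE ?permK ?permKV.
apply: eq_bigr => c _; congr (_ * (nat_of_bool _)%:R).
  rewrite (reindex_inj (@perm_inj _ s)) /=; apply: eq_bigr => j _.
  by rewrite ffunE permK.
rewrite /F_admissible /chained; apply: eq_forallb => j; apply: eq_forallb => k.
case: eqP => //= jk; rewrite /adjF add0n /h !ffunE !permK /desF jk /= -jk.
by rewrite !inord_val.
Qed.

Lemma K_E n (g s : 'S_n.+1) :
  K_ g s = tuplesum (fun i =>
    \sum_(e : bool) 1 * chain (fun=> 1) (adjK (fun k => i (s (inord k))) (desF (Des g))) n 1 e).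
Proof.
apply: tuplesum_ext => i; rewrite -(chain_sum (fun=> 1) _ n 0).
rewrite -sum1_card natr_sum big_mkcond /=; apply: eq_bigr => eps _.
rewrite big1 // mul1r inE.
have -> : K_admissible g (fun k => (-1) ^+ eps k * (i (s k)).+1%:Z) =
  chained (adjK (fun k => i (s (inord k))) (desF (Des g))) 0 eps.
  rewrite /K_admissible /chained; apply: eq_forallb => j; apply: eq_forallb => k.
  case: eqP => //= jk; rewrite /adjK add0n /desF jk /= -jk !inord_val.
  have -> : j \in Des g = (g k < g j)%N.
    rewrite inE; apply/existsP/idP => [[k' /andP[/eqP k'E]]|H].
      by have -> : k = k' by apply: val_inj; rewrite /= jk -k'E.
    by exists k; rewrite jk eqxx.
  have gjk : (g j < g k)%N = ~~ (g k < g j)%N.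
    rewrite -leqNgt ltn_neqAle; case: eqP => // /ord_inj/perm_inj ejk.
    by move: jk; rewrite ejk; lia.
  rewrite gjk /prec_le.
  by case: (eps j) (eps k) (g k < g j)%N => [] [] []; rewrite ?expr0 ?expr1; lia.
by case: chained.
Qed.

(** * Permutations with prescribed order or prescribed peaks *)

Section Ranks.
Variables (n : nat) (v : 'I_n -> nat).

Lemma rank_proof (i : 'I_n) : (#|[set j | (v j < v i)%N]| < n)%N.
Proof.
rewrite -[X in (_ < X)%N]card_ord -cardsT; apply: proper_card.
by apply/properP; split; [exact: finset.subsetT | exists i; rewrite ?inE ?ltnn].
Qed.

(** Equal values share a rank. Injective v thus yield permutations, while for arbitrary v the ranks
    serve below as the canonical representative of an order type. *)
Definition rank (i : 'I_n) : 'I_n := Ordinal (rank_proof i).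

Lemma rank_lt i k : (rank i < rank k)%N = (v i < v k)%N.
Proof.
case: (ltnP (v i) (v k)) => [lt_ik|le_ki].
  apply: proper_card; apply/properP; split.
    by apply/subsetP => j; rewrite !inE => /ltn_trans; apply.
  by exists i; rewrite !inE ?lt_ik ?ltnn.
apply/negbTE; rewrite -leqNgt /rank /=; apply: subset_leq_card.
by apply/subsetP => j; rewrite !inE => /leq_trans; apply.
Qed.

Lemma rank_eq i k : (rank i == rank k) = (v i == v k).
Proof.
have := rank_lt i k; have := rank_lt k i; rewrite -(inj_eq (@ord_inj n)).
by move: (rank i) (rank k) => a b; lia.
Qed.

Lemma rank_perm : injective v ->
  exists g : 'S_n, forall i k, (g i < g k)%N = (v i < v k)%N.
Proof.
move=> inj_v; have inj_r : injective rank.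
  by move=> i k /eqP; rewrite rank_eq => /eqP/inj_v.
by exists (perm inj_r) => i k; rewrite !permE rank_lt.
Qed.

End Ranks.

Lemma Peak_Des n (g : 'S_n) : Peak g = peaks_of_des (Des g).
Proof.
apply/setP => i; rewrite !inE; apply/existsP/andP.
  case=> h /existsP[j /and4P[/eqP ih /eqP ji lt_h lt_j]]; split; last first.
    by apply/existsP; exists j; rewrite ji eqxx.
  apply/norP; split; last by rewrite ih.
  apply/existsPn => k; rewrite inE; apply/negP => /andP[/existsP[l /andP[/eqP lk lt_lk]]].
  move=> /eqP ik; have hk : h = k by apply: ord_inj; lia.
  have li : l = i by apply: ord_inj; lia.
  by move: lt_lk; rewrite -hk li; lia.
case=> /norP[noD i0] /existsP[j /andP[ji lt_j]].
have lt_h : (i.-1 < n)%N by have := ltn_ord i; lia.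
exists (Ordinal lt_h); apply/existsP; exists j; rewrite ji lt_j andbT /=.
have ih : i = (Ordinal lt_h).+1 :> nat by rewrite /=; lia.
rewrite {1}ih eqxx /= ltnNge leq_eqVlt; apply/negP => /orP[/eqP/ord_inj/perm_inj E|lt_i].
  by move: ih; rewrite -E; lia.
case/existsP: noD; exists (Ordinal lt_h); rewrite {2}ih eqxx andbT inE.
by apply/existsP; exists i; rewrite lt_i {1}ih eqxx.
Qed.

(** In an increasing sequence the positions of B are lifted by n. They become the peaks because B
    contains neither end of [n] nor two adjacent positions. *)
Lemma perm_with_peaks n (A : {set 'I_n}) : A \subset interior_ord n ->
  exists g : 'S_n, Peak g = peaks_of_des A.
Proof.
move=> /subsetP subA; pose B := peaks_of_des A.
pose v (i : 'I_n) := (if i \in B then n + i else i)%N.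
have vinj : injective v.
  move=> i k; rewrite /v; have [hi hk] := (ltn_ord i, ltn_ord k).
  by do 2!case: ifP => _; move=> E; apply: ord_inj; lia.
have [g gv] := rank_perm vinj; exists g; apply/setP => i; rewrite -/B.
rewrite inE; apply/existsP/idP.
  case=> h /existsP[j /and4P[/eqP ih /eqP ji _]]; rewrite gv /v.
  by case: ifP => //; case: ifP => // _ _; lia.
move=> iB; have := iB; rewrite !inE => /andP[/norP[noA i0] iA].
have lt_i : (i.+1 < n)%N by have := subA _ iA; rewrite inE.
have lt_h : (i.-1 < n)%N by have := ltn_ord i; lia.
have ih : i = (Ordinal lt_h).+1 :> nat by rewrite /=; lia.
exists (Ordinal lt_h); apply/existsP; exists (Ordinal lt_i).
rewrite {1}ih !eqxx !gv /v iB.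
have -> : Ordinal lt_h \in B = false.
  apply/negP; rewrite !inE => /andP[_ hA]; case/existsP: noA.
  by exists (Ordinal lt_h); rewrite hA {1}ih eqxx.
have -> : Ordinal lt_i \in B = false.
  apply/negP; rewrite !inE => /andP[/norP[/existsPn/(_ i)]].
  by rewrite iA eqxx.
by rewrite /=; have := ltn_ord i; lia.
Qed.

Lemma desF_peaks n (A : {set 'I_n.+1}) j : (0 < j)%N -> (j < n.+1)%N ->
  desF (peaks_of_des A) j = desF A j && ~~ desF A j.-1.
Proof.
move=> j0 jn; rewrite /desF !inE andbC !(inordK jn) (gtn_eqF j0) orbF.
congr (_ && ~~ _); apply/existsP/idP => [[h /andP[hA /eqP jh]]|H].
  by rewrite jh /= inord_val.
by exists (inord j.-1); rewrite H inordK ?prednK //=; lia.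
Qed.

Lemma sum_chain_peaks y D n : 
  \sum_(e : bool) 1 * chain (fun=> 1) (adjK y D) n 1 e =
  chain (fun=> 1) (adjK y D) n 1 true + chain (fun=> 1) (adjK y D) n 1 false.
Proof. by rewrite big_bool /= !mul1r. Qed.

(** [chain_peaks] evaluates both chain sums, the one for A and the one for the descents of g, to the
    same [peak_chain]. *)
Lemma Psi_F_K n (A : {set 'I_n}) (g s : 'S_n) :
  Peak g = peaks_of_des A -> Psi 1 (F_ A s) = K_ g s.
Proof.
case: n A g s => [|n] A g s gA.
  rewrite /F_ Psi_tuplesum; apply: tuplesum_ext => i.
  rewrite big_ord_recl big_ord0 addr0 /extrap_coef binn expr0 !mul1r.
  have cE (S : finType) : #|{ffun 'I_0 -> S}| = 1%N by rewrite card_ffun card_ord expn0.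
  transitivity (\sum_(c : {ffun 'I_0 -> 'I_1}) 1 : rat).
    apply: eq_bigr => c _; rewrite big_ord0 mul1r.
    by rewrite (_ : F_admissible _ _ = true) //; apply/forallP => -[].
  rewrite sumr_const cE; congr (_%:R); rewrite -(cE bool).
  apply: eq_card => eps; rewrite !inE.
  by symmetry; apply/forallP => -[].
rewrite Psi_F K_E; apply: tuplesum_ext => i; rewrite !sum_chain_peaks.
have [|-> _] := @chain_peaks (fun k => i (s (inord k))) (desF A)
    (desF (peaks_of_des A)) n 1.
  by move=> j j1 jn; apply: desF_peaks => //; lia.
have [|-> _] // := @chain_peaks (fun k => i (s (inord k))) (desF (Des g))
    (desF (peaks_of_des A)) n 1.
by move=> j j1 jn; rewrite -gA Peak_Des; apply: desF_peaks => //; lia.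
Qed.

(** [perm_with_peaks] guarantees that the [pick] in [K_peak] succeeds, and [Psi_F_K] applies to
    whichever permutation it returns. *)
Lemma Psi_is_Theta : is_Theta (Psi 1).
Proof.
split=> [a u v _ _|n A s subA _]; first exact: Psi_linear.
have [g gA] := perm_with_peaks subA.
rewrite /K_peak; case: pickP => [g' /eqP g'A|/(_ g)]; last by rewrite gA eqxx.
exact: Psi_F_K.
Qed.

(** * Linear algebra *)

Lemma subspace_lspan X : subspace (lspan X).
Proof.
split=> [S [[] ]//|a u v hu hv S SX].
by case: (SX) => -[_ hS] _; apply: hS; [apply: hu | apply: hv].
Qed.

Lemma lspan_mem (X : set ncseries) f : X f -> lspan X f.
Proof. by move=> Xf S [_]; apply. Qed.

Lemma lspan_min (X S : set ncseries) :
  subspace S -> (forall f, X f -> S f) -> forall f, lspan X f -> S f.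
Proof. by move=> Ssub XS f; apply. Qed.

Section Subspaces.
Variables (S : set ncseries) (subS : subspace S).

Lemma subspaceD f g : S f -> S g -> S (f + g).
Proof. by case: subS => _ hS Sf Sg; rewrite -[f]scale1r; apply: hS. Qed.

Lemma subspaceZ a f : S f -> S (a *: f).
Proof. by case: subS => S0 hS Sf; rewrite -[_ *: _]addr0; apply: hS. Qed.

Lemma subspace_sum (I : Type) (r : seq I) (P : pred I) (F : I -> ncseries) :
  (forall i, P i -> S (F i)) -> S (\sum_(i <- r | P i) F i).
Proof.
case: subS => S0 _ SF; elim/big_ind: _ => //; exact: subspaceD.
Qed.

End Subspaces.

Section LinearOn.
Variables (W : set ncseries) (T : ncseries -> ncseries).
Hypotheses (subW : subspace W) (linT : linear_on W T).

Lemma linear_on0 : T 0 = 0.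
Proof.
have [W0 _] := subW; have := linT 1 W0 W0.
by rewrite !scale1r addr0 => /esym/(canRL (addrK _)); rewrite subrr.
Qed.

Lemma linear_onZ a f : W f -> T (a *: f) = a *: T f.
Proof.
have [W0 _] := subW.
by move=> Wf; have := linT a Wf W0; rewrite !addr0 linear_on0 addr0.
Qed.

Lemma linear_on_sum (I : Type) (r : seq I) (P : pred I) (F : I -> ncseries) :
  (forall i, P i -> W (F i)) ->
  T (\sum_(i <- r | P i) F i) = \sum_(i <- r | P i) T (F i).
Proof.
move=> WF; elim: r => [|i r IHr]; first by rewrite !big_nil linear_on0.
rewrite !big_cons; case: ifP => // Pi.
have := linT 1 (WF _ Pi) (subspace_sum subW r WF).
by rewrite !scale1r IHr.
Qed.

Lemma linear_on_eq T' X : linear_on W T' -> (forall f, lspan X f -> W f) ->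
  (forall f, X f -> T f = T' f) -> forall f, lspan X f -> T f = T' f.
Proof.
move=> linT' XW XT f Xf.
(* Linearity is available inside W only, so membership in W is carried through the span together
   with the equality. *)
suff [] : W f /\ T f = T' f by [].
apply: (@lspan_min X (fun g => W g /\ T g = T' g) _ _ f Xf) => [|g Xg]; last first.
  split; last exact: XT.
  exact: XW (lspan_mem Xg).
have [W0 hW] := subW; split.
  split=> //; rewrite linear_on0.
  by have := linT' 1 _ _ W0 W0; rewrite !scale1r addr0 => /esym/(canRL (addrK _)); rewrite subrr.
by move=> a u v [Wu Tu] [Wv Tv]; split; [exact: hW | rewrite linT // linT' // Tu Tv].
Qed.

End LinearOn.

Section Triangular.
Variables (I : finType) (D : pred I) (C : I -> I -> rat) (r : I -> nat).
Variables (p b : I -> ncseries).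
Hypothesis diagC : forall i, D i -> C i i != 0.
Hypothesis triC : forall i j, D i -> D j -> C i j != 0 -> j = i \/ (r j < r i)%N.
Hypothesis bE : forall i, D i -> b i = \sum_(j | D j) C i j *: p j.

Lemma triangular_span (S : set ncseries) : subspace S ->
  (forall i, D i -> S (b i)) -> forall i, D i -> S (p i).
Proof.
move=> subS Sb i; have [m] := ubnP (r i).
elim: m i => // m IHm i; rewrite ltnS => le_m Di.
have -> : p i = (C i i)^-1 *: (b i + (-1) *: \sum_(j | D j && (j != i)) C i j *: p j).
  rewrite bE // (bigD1 i) //= scaleN1r addrK scalerA mulVf ?scale1r //.
  exact: diagC.
apply: subspaceZ => //; apply: subspaceD => //; first exact: Sb.
apply: subspaceZ => //; apply: subspace_sum => // j /andP[Dj ji].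
have [->|nz] := eqVneq (C i j) 0; first by rewrite scale0r; case: subS.
apply: subspaceZ => //; apply: IHm => //.
case: (triC Di Dj nz) => [eij|lt]; first by rewrite eij eqxx in ji.
exact: leq_trans lt le_m.
Qed.

Definition independent_on (f : I -> ncseries) := forall c : I -> rat,
  \sum_(i | D i) c i *: f i = 0 -> forall i, D i -> c i = 0.

(** Take k of maximal rank among the indices with nonzero coefficient. No other b j in the relation
    involves p k, so the coefficient of p k is c k times a nonzero diagonal entry. *)
Lemma triangular_indep : independent_on p -> independent_on b.
Proof.
move=> indp c; under eq_bigr => i Di do rewrite bE // scaler_sumr.
rewrite exchange_big /=; under eq_bigr => j Dj.
  under eq_bigr do rewrite scalerA.
  rewrite -scaler_suml; over.
move=> /indp E i Di; apply/eqP; apply: contraT => ci.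
pose P k := D k && (c k != 0); have Pi : P i by rewrite /P Di.
case: (@arg_maxnP _ i P r Pi) => k /andP[Dk ck] maxk.
have := E k Dk; rewrite (bigD1 k) //= big1 ?addr0 => [/eqP|j /andP[Dj jk]].
  by rewrite mulf_eq0 (negPf ck) (negPf (diagC Dk)).
have [->|cj] := eqVneq (c j) 0; first by rewrite mul0r.
have [->|nz] := eqVneq (C j k) 0; first by rewrite mulr0.
case: (triC Dj Dk nz) => [ejk|]; first by rewrite ejk eqxx in jk.
by have /= := maxk j; rewrite /P Dj cj leqNgt => /(_ isT)/negPf->.
Qed.

End Triangular.

(** A word sees only the terms of its own degree, so a relation splits by degree. In one degree it
    extends to a sum over the whole finite type, with coefficient 0 outside s. *)
Lemma lin_indep_graded (D : pred anypart) (b : anypart -> ncseries) :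
  (forall x w, size w != tag x -> b x w = 0) ->
  (forall n, independent_on (fun pi : setpart n => D (Tagged setpart pi))
                            (fun pi => b (Tagged setpart pi))) ->
  lin_indep D b.
Proof.
move=> homb indb s c us Ds E [n pi] xs.
pose c' (sg : setpart n) : rat :=
  if Tagged setpart sg \in s then c (Tagged setpart sg) else 0.
suff E' : \sum_(sg : setpart n | D (Tagged setpart sg)) c' sg *: b (Tagged setpart sg) = 0.
  have := indb n c' E' pi (allP Ds _ xs).
  by rewrite /c' xs.
apply/funext => w; rewrite fct_sumE.
have [wn|wn] := eqVneq (size w) n; last first.
  rewrite big1 // => sg _.
  by rewrite [LHS](_ : _ = c' sg * b (Tagged setpart sg) w) // homb ?mulr0.
move/(congr1 (fun f => f w)): E; rewrite fct_sumE => <-.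
rewrite [RHS](bigID (fun x => tag x == n)) /= [X in _ + X]big1 ?addr0; last first.
  move=> x xn; rewrite [LHS](_ : _ = c x * b x w) // homb ?mulr0 //.
  by rewrite wn eq_sym.
rewrite -[RHS]big_filter.
have pe : perm_eq [seq x <- s | tag x == n]
   [seq Tagged setpart sg | sg : setpart n <- enum {: setpart n} & Tagged setpart sg \in s].
  apply: uniq_perm; first exact: filter_uniq.
    rewrite map_inj_uniq; first exact/filter_uniq/enum_uniq.
    by move=> u v /eqP; rewrite eq_Tagged => /eqP.
  move=> x; rewrite mem_filter; apply/andP/mapP.
    case: x => k sg [/eqP /= kn ks]; subst k.
    by exists sg => //; rewrite mem_filter ks mem_enum.
  by case=> sg'; rewrite mem_filter => /andP[sg's _] ->.
rewrite (perm_big _ pe) big_map big_filter big_enum_cond /=.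
rewrite big_mkcond [RHS]big_mkcond; apply: eq_bigr => sg _ /=.
rewrite [LHS](_ : _ = if D (Tagged setpart sg)
  then c' sg * b (Tagged setpart sg) w else 0); last by case: ifP.
rewrite /c'; case: ifP => hD; case: ifP => ss; rewrite ?mul0r //.
by rewrite (allP Ds _ ss) in hD.
Qed.

(** * Set partitions and power sums *)

Section SameBlock.
Variables (n : nat) (pi : setpart n).
Implicit Types j k : 'I_n.

Lemma mem_cover_setpart j : j \in cover (val pi).
Proof. by rewrite (cover_partition (valP pi)) inE. Qed.

Lemma same_blockE j k :
  same_block pi j k = (pblock (val pi) j == pblock (val pi) k).
Proof.
have /and3P[_ triv _] := valP pi.
by rewrite /same_block -eq_pblock // mem_cover_setpart.
Qed.

Lemma pblock_setpart j : pblock (val pi) j \in val pi.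
Proof. exact/pblock_mem/mem_cover_setpart. Qed.

Lemma pblock_eq B j : B \in val pi -> (pblock (val pi) j == B) = (j \in B).
Proof.
have /and3P[_ triv _] := valP pi.
move=> BP; apply/eqP/idP => [<-|jB]; first by rewrite mem_pblock mem_cover_setpart.
exact: def_pblock.
Qed.

Lemma setpart_block B : B \in val pi -> exists j, B = pblock (val pi) j.
Proof.
have /and3P[_ triv n0] := valP pi.
move=> BP; have [B0|[j jB]] := set_0Vmem B; first by rewrite -B0 BP in n0.
by exists j; apply/esym/eqP; rewrite pblock_eq.
Qed.

Lemma val_setpart : val pi = [set pblock (val pi) j | j : 'I_n].
Proof.
apply/setP => B; apply/idP/imsetP => [/setpart_block[j ->]|[j _ ->]].
  by exists j.
exact: pblock_setpart.
Qed.

Lemma card_setpart : (#|val pi| <= n)%N.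
Proof. by rewrite val_setpart -[leqRHS]card_ord leq_imset_card. Qed.

Lemma prod_blocks (G : 'I_n -> rat) :
  \prod_j G j = \prod_(B in val pi) \prod_(j in B) G j.
Proof.
rewrite (partition_big (pblock (val pi)) (mem (val pi))) => [|j _] /=; last first.
  exact: pblock_setpart.
by apply: eq_bigr => B BP; apply: eq_bigl => j; rewrite pblock_eq.
Qed.

End SameBlock.

Lemma setpart_ext n (pi sg : setpart n) :
  (forall j k, same_block pi j k = same_block sg j k) -> pi = sg.
Proof.
move=> E; apply: val_inj; rewrite /= (val_setpart pi) (val_setpart sg).
by apply: eq_imset => j; apply/setP => k; apply: E.
Qed.

Definition part_of n (T : eqType) (f : 'I_n -> T) : setpart n :=
  exist (fun P : {set {set 'I_n}} => is_true (partition P [set: 'I_n]))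
    _ (preim_partitionP f [set: 'I_n]).

Lemma same_part_of n (T : eqType) (f : 'I_n -> T) j k :
  same_block (part_of f) j k = (f j == f k).
Proof.
rewrite /same_block /= pblock_equivalence_partition ?inE //.
by split=> // /eqP->.
Qed.

Definition finer n (pi sg : setpart n) : bool :=
  [forall j, forall k, same_block pi j k ==> same_block sg j k].

Lemma finerP n (pi sg : setpart n) :
  reflect (forall j k, same_block pi j k -> same_block sg j k) (finer pi sg).
Proof.
apply: (iffP forallP) => [H j k|H j]; last by apply/forallP => k; apply/implyP/H.
by apply: implyP; apply/forallP: k.
Qed.

(** A rank for triangularity: it grows strictly when a partition is coarsened. *)
Definition npairs n (pi : setpart n) : nat :=
  #|[set jk : 'I_n * 'I_n | same_block pi jk.1 jk.2]|.

Lemma finer_npairs n (pi sg : setpart n) : finer pi sg ->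
  sg = pi \/ (npairs pi < npairs sg)%N.
Proof.
move/finerP => le_ps; have [->|ne] := eqVneq sg pi; [by left | right].
apply: proper_card; rewrite properEneq; apply/andP; split.
  apply: contraNneq ne => E; apply/eqP/setpart_ext => j k.
  by have /setP/(_ (j, k)) := E; rewrite !inE.
by apply/subsetP => -[j k]; rewrite !inE; apply: le_ps.
Qed.

Lemma sum_tuplesum n (I : Type) (r : seq I) (P : pred I) (c : I -> rat)
    (f : I -> ('I_n -> nat) -> rat) :
  \sum_(x <- r | P x) c x *: tuplesum (f x) =
  tuplesum (fun i => \sum_(x <- r | P x) c x * f x i).
Proof.
apply/funext => w; rewrite fct_sumE /tuplesum /=.
transitivity (\sum_(x <- r | P x) c x *
   (if size w == n then f x (fun j => nth 0%N w j) else 0)); first by [].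
by case: eqP => // _; rewrite big1 // => x _; rewrite mulr0.
Qed.

Lemma scale_tuplesum n a (f : ('I_n -> nat) -> rat) :
  a *: tuplesum f = tuplesum (fun i => a * f i).
Proof.
apply/funext => w; rewrite /tuplesum.
transitivity (a * (if size w == n then f (fun j => nth 0%N w j) else 0)); first by [].
by case: eqP; rewrite ?mulr0.
Qed.

Lemma tuplesum_homog n (c : ('I_n -> nat) -> rat) w : size w != n -> tuplesum c w = 0.
Proof. by rewrite /tuplesum => /negPf->. Qed.

Lemma m_E n (pi : setpart n) : m_ pi = tuplesum (fun i => (part_of i == pi)%:R).
Proof.
apply: tuplesum_ext => i; congr (nat_of_bool _)%:R.
apply/forallP/eqP => [H|<- j]; last first.
  by apply/forallP => k; rewrite same_part_of.
apply: setpart_ext => j k; rewrite same_part_of.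
by have /forallP/(_ k)/eqP := H j.
Qed.

Lemma p_E n (pi : setpart n) : p_ pi = tuplesum (fun i => (finer pi (part_of i))%:R).
Proof.
apply: tuplesum_ext => i; congr (nat_of_bool _)%:R.
by apply: eq_forallb => j; apply: eq_forallb => k; rewrite same_part_of.
Qed.

Lemma p_sum_m n (pi : setpart n) :
  p_ pi = \sum_(sg : setpart n) (finer pi sg)%:R *: m_ sg.
Proof.
under eq_bigr do rewrite m_E.
rewrite sum_tuplesum p_E; apply: tuplesum_ext => i.
rewrite (bigD1 (part_of i)) //= eqxx mulr1 big1 ?addr0 // => sg.
by rewrite eq_sym => /negPf->; rewrite mulr0.
Qed.

Lemma finer_refl n (pi : setpart n) : finer pi pi.
Proof. exact/finerP. Qed.

Lemma m_indep n : independent_on predT (@m_ n).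
Proof.
move=> c E pi _.
(* The word that writes at each position the number of its block has pi as its partition of
   coincidences, so it occurs in [m_ pi] and in no other [m_]. *)
have same_i : part_of (fun j => enum_rank (pblock (val pi) j) : nat) = pi.
  apply: setpart_ext => j k.
  by rewrite same_part_of same_blockE (inj_eq (@ord_inj _)) (inj_eq enum_rank_inj).
move: same_i; set i := (fun j => _) => same_i.
pose w := [seq i j | j <- enum 'I_n].
move/(congr1 (fun f => f w)): E.
under eq_bigr do rewrite m_E.
rewrite sum_tuplesum /tuplesum size_map size_enum_ord eqxx.
have -> : (fun j : 'I_n => nth 0%N w j) = i.
  by apply/funext => j; rewrite (nth_map j) ?size_enum_ord // nth_ord_enum.
rewrite (bigD1 pi) //= same_i eqxx mulr1 big1 ?addr0 // => sg.
by rewrite eq_sym => /negPf->; rewrite mulr0.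
Qed.

(** A power sum expands in the [m_] of coarser partitions, so the rank has to be reversed; n * n
    bounds the number of pairs. *)
Lemma p_triangular n (pi sg : setpart n) : (finer pi sg)%:R != 0 :> rat ->
  sg = pi \/ (n * n - npairs sg < n * n - npairs pi)%N.
Proof.
case fin : finer => // _; have [->|lt] := finer_npairs fin; [by left | right].
rewrite ltn_sub2l //; apply: leq_trans lt _.
by rewrite -[n in leqRHS]card_ord -card_prod max_card.
Qed.

Lemma p_indep n : independent_on predT (@p_ n).
Proof.
apply: (@triangular_indep _ _ (fun pi sg => (finer pi sg)%:R)
  (fun pi => n * n - npairs pi)%N _ _ _ _ _ (@m_indep n)) => [pi _|pi sg _ _|pi _].
- by rewrite finer_refl oner_eq0.
- exact: p_triangular.
- exact: p_sum_m.
Qed.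

Definition p_family : set ncseries := fun f => exists n (pi : setpart n), f = p_ pi.

Lemma NCSym_p : NCSym = lspan p_family.
Proof.
apply/funext => f; apply/propext; split; apply: lspan_min.
- exact: subspace_lspan.
- move=> _ [n [pi ->]].
  apply: (@triangular_span _ predT (fun pi sg => (finer pi sg)%:R)
     (fun pi => n * n - npairs pi)%N _ (@p_ n)) => //.
  + by move=> sg _; rewrite finer_refl oner_eq0.
  + by move=> sg tau _ _; exact: p_triangular.
  + by move=> sg _; exact: p_sum_m.
  + exact: subspace_lspan.
  + by move=> sg _; apply: lspan_mem; exists n, sg.
- exact: subspace_lspan.
- move=> _ [n [pi ->]]; rewrite p_sum_m.
  apply: (subspace_sum (subspace_lspan _)) => sg _.
  apply: (subspaceZ (subspace_lspan _)).
  by apply: lspan_mem; exists n, sg.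
Qed.

Definition p_scale (t : rat) n (pi : setpart n) : rat :=
  \prod_(B in val pi) (t ^+ #|B| - (-1) ^+ #|B|).

(** A colouring constant on blocks is a choice of one colour per block. [big_distr_big] ranges over
    functions on all subsets, pinned to [x0] off the blocks, which is the role of the default in
    [h']. *)
Lemma sum_block_constant n (pi : setpart n) (X : finType) (x0 : X) (G : X -> rat) :
  \sum_(c : {ffun 'I_n -> X} | finer pi (part_of c)) \prod_j G (c j)
  = \prod_(B in val pi) \sum_x G x ^+ #|B|.
Proof.
rewrite (big_distr_big x0) /=.
pose h (d : {ffun {set 'I_n} -> X}) : {ffun 'I_n -> X} :=
  [ffun j => d (pblock (val pi) j)].
pose h' (c : {ffun 'I_n -> X}) : {ffun {set 'I_n} -> X} :=
  [ffun B : {set 'I_n} => if [pick j in B] is Some j then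
     (if B \in val pi then c j else x0) else x0].
have hK (c : {ffun 'I_n -> X}) : finer pi (part_of c) -> h (h' c) = c.
  move=> /finerP fin; apply/ffunP => j; rewrite !ffunE pblock_setpart.
  case: pickP => [k jk|/(_ j)]; last by rewrite mem_pblock mem_cover_setpart.
  by apply/esym/eqP; have := fin j k jk; rewrite same_part_of.
rewrite (reindex_onto h h') //; symmetry.
apply: eq_big => [d|d _]; last first.
  rewrite (prod_blocks pi); apply: eq_bigr => B BP.
  rewrite (eq_bigr (fun=> G (d B))) ?prodr_const // => j jB.
  by move: jB; rewrite -(pblock_eq _ BP) => /eqP jB; rewrite ffunE jB.
have -> : finer pi (part_of (h d)).
  by apply/finerP => j k; rewrite same_part_of !ffunE same_blockE => /eqP->.
apply/pffun_onP/eqP => [[supp _]|<-].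
  apply/ffunP => B; rewrite ffunE.
  have notP : B \notin val pi -> d B = x0.
    move=> BnP; apply/eqP; apply: contraNT BnP => dB.
    by apply: (subsetP supp); rewrite inE.
  case: pickP => [j jB|B0]; last first.
    rewrite notP //; apply/negP => /setpart_block[j Bj].
    by have := B0 j; rewrite Bj mem_pblock mem_cover_setpart.
  case: ifP => [BP|/negbT/notP->//].
  have -> : B = pblock (val pi) j by apply/esym/eqP; rewrite pblock_eq.
  by rewrite ffunE.
split=> //; apply/subsetP => B; rewrite inE ffunE.
case: pickP => [j _|_]; last by rewrite eqxx.
by case: ifP => // _; rewrite eqxx.
Qed.

Lemma sum_copy_sign t N k :
  \sum_(x : 'I_N.+1) copy_sign t x ^+ k = N%:R * (-1) ^+ k + t ^+ k.
Proof.
rewrite big_ord_recr /= /copy_sign ltnn; congr (_ + _).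
under eq_bigr => x _ do rewrite /= ltn_ord.
by rewrite sumr_const card_ord mulr_natl.
Qed.

(** By quotient and remainder modulo N + 1, the letters i j (N + 1) + c j agree on the blocks iff i
    and c both do. The sum over c therefore factors out, as a product over blocks of power sums of
    the weights. *)
Lemma Psi_p t n (pi : setpart n) : Psi t (p_ pi) = p_scale t pi *: p_ pi.
Proof.
rewrite p_E Psi_tuplesum.
rewrite scale_tuplesum; apply: tuplesum_ext => i.
pose f m : rat := \prod_(B in val pi) ((m%:R - 1) * (-1) ^+ #|B| + t ^+ #|B|).
have hf : lowdeg n.+1 f.
  apply: (@lowdeg_leq #|val pi|.+1); first by rewrite ltnS card_setpart.
  rewrite cardE; apply: lowdeg_ext (lowdeg_prod (enum (val pi)) (f := fun (B : {set 'I_n}) m =>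
    (m%:R - 1) * (-1) ^+ #|B| + t ^+ #|B|) _) => [m|B m]; first by rewrite /f big_enum.
  by rewrite -!natr1; ring.
have f0 : f 0%N = p_scale t pi by apply: eq_bigr => B _; ring.
rewrite -f0 -(extrapolate hf) mulr_suml; apply: eq_bigr => N _.
rewrite -[RHS]mulrA; congr (_ * _).
have fN : f N.+1 = \prod_(B in val pi) \sum_(x : 'I_N.+1) copy_sign t x ^+ #|B|.
  by apply: eq_bigr => B _; rewrite sum_copy_sign -natr1 addrK.
rewrite fN -(sum_block_constant _ ord0) mulr_suml [RHS]big_mkcond /=.
apply: eq_bigr => c _.
have -> : finer pi (part_of (fun j => i j * N.+1 + c j)%N) =
   finer pi (part_of c) && finer pi (part_of i).
  apply/finerP/andP => [H|[/finerP H1 /finerP H2] j k jk].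
    split; apply/finerP => j k /H; rewrite !same_part_of => /eqP E; apply/eqP.
      apply: ord_inj; have := congr1 (modn^~ N.+1) E.
      by rewrite !modnMDl !modn_small.
    have := congr1 (divn^~ N.+1) E.
    by rewrite !divnMDl // !divn_small // !addn0.
  have := H1 _ _ jk; have := H2 _ _ jk.
  by rewrite !same_part_of => /eqP-> /eqP->.
by case: ifP => _ /=; rewrite ?mulr0.
Qed.

(** * Expansion of h and e in power sums *)

(** Each element of S contributes its rank within S. This spreads the factorials of [h_] over single
    positions. *)
Lemma prod_rank_fact n (S : {set 'I_n}) :
  (\prod_(j in S) #|[set k in S | (k <= j)%N]| = (#|S|)`!)%N.
Proof.
have [m] := ubnP #|S|; elim: m S => // m IHm S; rewrite ltnS => leS.
have [->|[x xS]] := set_0Vmem S; first by rewrite big_set0 cards0.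
case: (@arg_maxnP _ x (fun j => j \in S) val xS) => /= y yS maxy.
have cS : #|S| = #|S :\ y|.+1 by rewrite (cardsD1 y) yS.
rewrite (big_setD1 y) //= cS factS -IHm -?cS //; congr (_ * _)%N.
  by apply: eq_card => k; rewrite !inE andb_idr // => /maxy.
apply: eq_bigr => j; rewrite !inE => /andP[jy jS].
apply: eq_card => k; rewrite !inE andbC [RHS]andbC; case: leqP => //= le_kj.
rewrite andb_idl // => kS; apply: contraNneq jy => eky; apply/eqP/ord_inj.
by have /= := maxy _ jS; rewrite -eky; lia.
Qed.

Lemma partition_values (n : nat) (i : 'I_n -> nat) (P : pred 'I_n) (F : 'I_n -> nat) :
  (\prod_(v <- undup (codom i)) \prod_(j | P j && (i j == v)) F j = \prod_(j | P j) F j)%N.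
Proof.
rewrite (exchange_big_dep P) /= => [|v j _ /andP[] //]; apply: eq_bigr => j Pj.
rewrite (eq_bigl (fun v => v == i j)) => [|v]; last by rewrite Pj eq_sym.
by rewrite -big_filter filter_pred1_uniq ?big_seq1 ?undup_uniq // mem_undup codom_f.
Qed.

(** Factor j counts the partners k <= j of j in the same block with the same letter. As a product of
    sums over partners it can be expanded into maps from positions to partners. *)
Lemma h_E n (pi : setpart n) : h_ pi = tuplesum (fun i =>
  \prod_(j : 'I_n) \sum_(k : 'I_n) [&& (k <= j)%N, same_block pi j k & i k == i j]%:R).
Proof.
apply: tuplesum_ext => i; rewrite (prod_blocks pi) natr_prod.
apply: eq_bigr => B BP.
under [RHS]eq_bigr => j jB.
  rewrite -natr_sum.
  have -> : (\sum_(k < n) [&& (k <= j)%N, same_block pi j k & i k == i j] =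
     #|[set k in [set k in B | i k == i j] | (k <= j)%N]|)%N.
    rewrite -sum1_card [RHS]big_mkcond /=; apply: eq_bigr => k _.
    rewrite !inE; have -> : same_block pi j k = (k \in B).
      move: jB; rewrite -(pblock_eq j BP) => /eqP <-.
      by rewrite /same_block.
    by case: (k <= j)%N (k \in B) (i k == i j) => [] [] [].
  over.
rewrite -natr_prod -(partition_values i); congr (_%:R); apply: eq_bigr => v _.
have -> : [set j in B | i j == v] = [set j : 'I_n | (j \in B) && (i j == v)] by [].
rewrite -prod_rank_fact; apply: eq_big => [j|j]; rewrite !inE // => /andP[_ /eqP->].
by apply: eq_card => k; rewrite !inE.
Qed.

(* The factor of the least j having exactly one smaller partner vanishes. *)
Lemma e_E n (pi : setpart n) : e_ pi = tuplesum (fun i =>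
  \prod_(j : 'I_n) \sum_(k : 'I_n) [&& (k <= j)%N, same_block pi j k & i k == i j]%:R
     * (if k == j then 1 else -1)).
Proof.
apply: tuplesum_ext => i.
pose bad (j : 'I_n) := [exists k : 'I_n, [&& (k < j)%N, same_block pi j k & i k == i j]].
have [/existsP[x badx]|nobad] := boolP [exists j, bad j]; last first.
  have -> : [forall j, forall k, same_block pi j k && (j != k) ==> (i j != i k)].
    apply/forallP => j; apply/forallP => k; apply/implyP => /andP[jk njk].
    apply: contraNN nobad => eijk; apply/existsP.
    case: (ltngtP j k) => [lt|lt|/ord_inj E]; last by rewrite E eqxx in njk.
      exists k; apply/existsP; exists j; rewrite lt eijk andbT.
      by rewrite same_blockE eq_sym -same_blockE.
    by exists j; apply/existsP; exists k; rewrite lt jk eq_sym.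
  rewrite big1 // => j _; rewrite (bigD1 j) //= leqnn eqxx same_blockE !eqxx mulr1.
  rewrite big1 ?addr0 // => k kj.
  case: and3P => [[le_kj jk eik]|_]; last by rewrite mul0r.
  case/existsP: nobad; exists j; apply/existsP; exists k.
  by rewrite jk eik ltn_neqAle le_kj andbT (inj_eq (@ord_inj _)) kj.
case: (@arg_minnP _ x bad val badx) => y /existsP[k /and3P[lt_ky yk eik]] miny.
have -> : [forall j, forall k, same_block pi j k && (j != k) ==> (i j != i k)] = false.
  apply/negbTE/forallPn; exists y; apply/forallPn; exists k.
  by rewrite yk [i y == _]eq_sym eik -(inj_eq (@ord_inj _)) gtn_eqF.
rewrite (bigD1 y) //= (bigD1 y) //= leqnn eqxx same_blockE !eqxx mulr1.
have ky : k != y by rewrite -(inj_eq (@ord_inj _)) ltn_eqF.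
rewrite (bigD1 k) //= (ltnW lt_ky) eik yk (negPf ky) /= mul1r.
rewrite big1 ?addr0 ?subrr ?mul0r // => l /andP[ly lk].
case: and3P => [[le_ly yl eil]|_]; last by rewrite mul0r.
have symb a b : same_block pi a b -> same_block pi b a by rewrite !same_blockE eq_sym.
have lt_ly : (l < y)%N by rewrite ltn_neqAle le_ly andbT (inj_eq (@ord_inj _)).
have kl : same_block pi k l.
  by move: yk yl; rewrite !same_blockE => /eqP<-.
have eikl : i k = i l by rewrite (eqP eik) (eqP eil).
(* With a second smaller partner l, the larger of k and l would itself be bad, against the
   minimality of y. *)
exfalso; case: (ltngtP k l) => [lt|lt|/ord_inj E]; last by rewrite E eqxx in lk.
  have /miny /= : bad l by apply/existsP; exists k; rewrite lt symb //= eikl.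
  by rewrite leqNgt lt_ly.
have /miny /= : bad k by apply/existsP; exists l; rewrite lt kl /= eikl.
by rewrite leqNgt lt_ky.
Qed.

(* A map g with g j <= j is a forest of recursive trees on [n], whose roots are
   the fixed points of g; the trees are the blocks of [components g]. *)
Section Forests.
Variable n : nat.
Implicit Types (pi sg : setpart n) (g : {ffun 'I_n -> 'I_n}).

Definition root_of g (j : 'I_n) : 'I_n := iter n g j.

Definition components g : setpart n := part_of (root_of g).

Definition forest_in pi g : bool :=
  [forall j, (g j <= j)%N && same_block pi j (g j)].

Lemma forest_le pi g : forest_in pi g -> forall j, (g j <= j)%N.
Proof. by move=> /forallP gP j; case/andP: (gP j). Qed.

(** Every step that moves lowers the index, so n iterations, more than j, end at a fixed point. *)
Lemma root_of_fixed g : (forall j, (g j <= j)%N) -> forall j, g (root_of g j) = root_of g j.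
Proof.
move=> le_g j; rewrite /root_of.
have H m : g (iter m g j) = iter m g j \/ (iter m g j + m <= j)%N.
  elim: m => [|m [E|IH]]; first by right; rewrite addn0.
    by left; rewrite iterS E.
  have [E|ne] := eqVneq (g (iter m g j)) (iter m g j); first by left; rewrite iterS !E.
  right; rewrite iterS.
  have lt : (g (iter m g j) < iter m g j)%N.
    by rewrite ltn_neqAle le_g andbT (inj_eq (@ord_inj _)).
  by rewrite addnS; apply: leq_trans IH; rewrite -addSn leq_add2r.
by case: (H n) => //; have := ltn_ord j; lia.
Qed.

(** Invariance of f under single steps propagates to the root; conversely j and g j have the same
    root because the root is fixed. *)
Lemma same_components (T : eqType) g (f : 'I_n -> T) : (forall j, (g j <= j)%N) ->
  [forall j, f (g j) == f j] = finer (components g) (part_of f).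
Proof.
move=> le_g; apply/forallP/finerP => [H j k|H j].
  rewrite !same_part_of => /eqP E.
  have fr m l : f (iter m g l) = f l by elim: m => //= m <-; apply/eqP.
  by apply/eqP; rewrite -(fr n j) -(fr n k); congr f.
have := H (g j) j; rewrite !same_part_of; apply.
by rewrite {1}/root_of -iterSr iterS [g _](root_of_fixed le_g).
Qed.

Definition forest_count pi sg : rat :=
  #|[set g | forest_in pi g & components g == sg]|%:R.

Lemma forest_finer pi g : forest_in pi g -> finer (components g) pi.
Proof.
move=> gP; have le_g := forest_le gP.
have := same_components (fun j => pblock (val pi) j) le_g.
have -> : part_of (fun j => pblock (val pi) j) = pi.
  by apply: setpart_ext => j k; rewrite same_part_of same_blockE.
move=> <-; apply/forallP => j; have /forallP/(_ j)/andP[_] := gP.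
by rewrite same_blockE eq_sym.
Qed.

Lemma forest_count_diag pi : forest_count pi pi != 0.
Proof.
rewrite pnatr_eq0 -lt0n; apply/card_gt0P.
have ex j : exists k : 'I_n, same_block pi j k && [forall l, same_block pi j l ==> (k <= l)%N].
  have jj : same_block pi j j by rewrite same_blockE.
  case: (@arg_minnP _ j (same_block pi j) val jj) => k jk mink; exists k.
  by rewrite jk; apply/forallP => l; apply/implyP => /mink.
(* Sending every element to the least one of its block gives a forest whose trees are exactly the
   blocks. *)
pose g := [ffun j => xchoose (ex j)].
have gP : forest_in pi g.
  apply/forallP => j; rewrite ffunE; have /andP[-> /forallP/(_ j)] := xchooseP (ex j).
  by rewrite same_blockE eqxx /= => ->.
exists g; rewrite inE gP; apply/eqP/setpart_ext => j k; apply/idP/idP.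
  exact: (finerP _ _ (forest_finer gP)).
move=> jk; have gjk : g j = g k.
  rewrite !ffunE; apply: eq_xchoose => l.
  move: jk; rewrite same_blockE => /eqP jk.
  rewrite same_blockE jk -same_blockE; congr (_ && _).
  by apply: eq_forallb => m; rewrite same_blockE jk -same_blockE.
have /finerP rg : finer (components g) (components g) by exact: finer_refl.
have := same_components (root_of g) (forest_le gP).
rewrite finer_refl => /forallP H; rewrite same_part_of.
by rewrite -(eqP (H j)) -(eqP (H k)) gjk.
Qed.

Lemma forest_count_tri pi sg : forest_count pi sg != 0 ->
  sg = pi \/ (npairs sg < npairs pi)%N.
Proof.
rewrite pnatr_eq0 -lt0n => /card_gt0P[g]; rewrite inE => /andP[gP /eqP<-].
by case: (finer_npairs (forest_finer gP)) => [->|]; [left | right].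
Qed.

(** Distributing the product chooses a partner g j <= j for every j. The conditions i (g j) = i j
    then say together that i is constant on the trees of g. *)
Lemma prod_forest pi (wt : 'I_n -> 'I_n -> rat) (i : 'I_n -> nat) :
  \prod_(j : 'I_n) \sum_(k : 'I_n) [&& (k <= j)%N, same_block pi j k & i k == i j]%:R * wt k j
  = \sum_(g | forest_in pi g) (\prod_j wt (g j) j) * (finer (components g) (part_of i))%:R.
Proof.
rewrite bigA_distr_bigA /= [RHS]big_mkcond; apply: eq_bigr => g _.
rewrite big_split /= mulrC.
have -> : \prod_(j < n) [&& (g j <= j)%N, same_block pi j (g j) & i (g j) == i j]%:R
   = (forest_in pi g && [forall j, i (g j) == i j])%:R :> rat.
  rewrite -natr_prod; congr (_%:R).
  case: (boolP (_ && _)) => [/andP[/forallP gP /forallP ig]|].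
    by rewrite big1 // => j _; have /andP[-> ->] := gP j; rewrite ig.
  rewrite negb_and => /orP[]/forallPn[j bad]; rewrite (bigD1 j) //= -?andbA.
    by rewrite andbA (negPf bad).
  by rewrite (negPf bad) !andbF.
case: ifP => // [gP|_]; last by rewrite mulr0.
by rewrite same_components //; exact: forest_le gP.
Qed.

Lemma sum_forests pi (F : {ffun 'I_n -> 'I_n} -> rat) (c : setpart n -> rat) :
  (forall g, forest_in pi g -> F g = c (components g)) ->
  tuplesum (fun i => \sum_(g | forest_in pi g) F g * (finer (components g) (part_of i))%:R)
  = \sum_sg (forest_count pi sg * c sg) *: p_ sg.
Proof.
move=> Fc; under [RHS]eq_bigr do rewrite p_E.
rewrite sum_tuplesum; apply: tuplesum_ext => i.
rewrite (partition_big components xpredT) //=; apply: eq_bigr => sg _.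
rewrite (eq_bigr (fun=> c sg * (finer sg (part_of i))%:R)); last first.
  by move=> g /andP[gP /eqP <-]; rewrite Fc.
rewrite sumr_const -[LHS]mulr_natl mulrA /forest_count; congr (_%:R * _ * _).
by apply: eq_card => g; rewrite inE.
Qed.

Lemma h_sum_p pi : h_ pi = \sum_sg forest_count pi sg *: p_ sg.
Proof.
rewrite h_E; under [RHS]eq_bigr do rewrite -[forest_count _ _]mulr1.
rewrite -(@sum_forests pi (fun=> 1)) //; apply: tuplesum_ext => i.
rewrite (eq_bigr (fun g : {ffun 'I_n -> 'I_n} =>
   (\prod_(j < n) (1 : rat)) * (finer (components g) (part_of i))%:R)).
  rewrite -(prod_forest pi (fun _ _ => 1)); apply: eq_bigr => j _; apply: eq_bigr => k _.
  by rewrite mulr1.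
by move=> g _; rewrite big1.
Qed.

Lemma card_components g : (forall j, (g j <= j)%N) ->
  #|val (components g)| = #|[set j | g j == j]|.
Proof.
move=> le_g; have fix_root j : g j = j -> root_of g j = j.
  by rewrite /root_of => gj; elim: (n in iter n) => //= m ->.
rewrite -(@card_in_imset _ _ (pblock (val (components g)))).
  congr #|pred_of_set _|; rewrite [LHS]val_setpart; apply/setP => B.
  apply/imsetP/imsetP => -[j _ ->]; last first.
    by exists j.
  exists (root_of g j); first by rewrite inE root_of_fixed.
  apply/eqP; rewrite -same_blockE same_part_of (fix_root (root_of g j)) //.
  by rewrite root_of_fixed.
move=> j k; rewrite !inE => /eqP gj /eqP gk /eqP.
by rewrite -same_blockE same_part_of !fix_root // => /eqP.
Qed.

(** Both sides are (-1)^(n - number of trees): each tree has exactly one root, and the powers of 0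
    vanish because blocks are nonempty. *)
Lemma forest_sign g : (forall j, (g j <= j)%N) ->
  \prod_j (if g j == j then 1 else -1) = p_scale 0 (components g).
Proof.
move=> le_g; rewrite /p_scale.
rewrite (eq_bigr (fun B : {set 'I_n} => (-1) * \prod_(j in B) (-1))); last first.
  move=> B /setpart_block[j Bj]; rewrite prodr_const mulN1r expr0n.
  rewrite (_ : (#|B| == 0)%N = false) ?sub0r //.
  by apply/negbTE; rewrite cards_eq0; apply/set0Pn; exists j;
    rewrite Bj mem_pblock mem_cover_setpart.
rewrite big_split /= -(prod_blocks (components g) (fun=> -1)) !prodr_const card_components //.
rewrite (eq_bigr (fun j => (-1) * (if g j == j then -1 else 1))) => [|j _]; last first.
  by case: eqP; rewrite mulN1r ?opprK.
rewrite big_split /= prodr_const mulrC; congr (_ * _).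
by rewrite -big_mkcond prodr_const cardsE.
Qed.

(** The forests are those of [h_], with a sign for every non-root. Hence the coefficients differ
    from those of [h_] by the scalars of [Psi 0], which is why [Psi 0] sends [h_] to [e_]. *)
Lemma e_sum_p pi : e_ pi = \sum_sg (forest_count pi sg * p_scale 0 sg) *: p_ sg.
Proof.
rewrite e_E -(sum_forests (F := fun g => \prod_(j < n) (if g j == j then 1 else -1))).
  by apply: tuplesum_ext => i; rewrite -(prod_forest pi (fun k j => if k == j then 1 else -1)).
by move=> g gP; apply: forest_sign; exact: forest_le gP.
Qed.

End Forests.

Lemma Psi_sum t (I : Type) (r : seq I) (P : pred I) (F : I -> ncseries) :
  Psi t (\sum_(i <- r | P i) F i) = \sum_(i <- r | P i) Psi t (F i).
Proof.
apply: (@linear_on_sum (fun=> True)) => // a f g _ _; exact: Psi_linear.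
Qed.

Lemma Psi0 t : Psi t 0 = 0.
Proof.
apply: (@linear_on0 (fun=> True)) => // b u v _ _; exact: Psi_linear.
Qed.

Lemma PsiZ t a f : Psi t (a *: f) = a *: Psi t f.
Proof.
apply: (@linear_onZ (fun=> True)) => // b u v _ _; exact: Psi_linear.
Qed.

Lemma Psi_h t n (pi : setpart n) :
  Psi t (h_ pi) = \sum_sg (forest_count pi sg * p_scale t sg) *: p_ sg.
Proof.
rewrite h_sum_p Psi_sum; apply: eq_bigr => sg _.
by rewrite PsiZ Psi_p scalerA.
Qed.

Lemma p_scale_odd t n (pi : setpart n) : odd_blocks pi ->
  p_scale t pi = \prod_(B in val pi) (t ^+ #|B| + 1).
Proof.
move=> /forallP oddP; apply: eq_bigr => B BP.
have /implyP/(_ BP) oB := oddP B.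
by rewrite -signr_odd oB expr1 opprK.
Qed.

Lemma p_scale0_odd n (pi : setpart n) : odd_blocks pi -> p_scale 0 pi = 1.
Proof.
move=> oddP; rewrite p_scale_odd // big1 // => B BP.
have /implyP/(_ BP) oB := forallP oddP B.
by rewrite expr0n; case: #|B| oB => // *; rewrite add0r.
Qed.

Lemma p_scale0_sign n (pi : setpart n) : p_scale 0 pi * p_scale 0 pi = 1.
Proof.
rewrite -big_split big1 //= => B BP.
have -> : (0 : rat) ^+ #|B| = 0.
  have [j Bj] := setpart_block BP.
  rewrite expr0n (_ : (#|B| == 0)%N = false) //; apply/negbTE; rewrite cards_eq0.
  by apply/set0Pn; exists j;
    rewrite Bj mem_pblock mem_cover_setpart.
by rewrite sub0r mulrNN -expr2 sqrr_sign.
Qed.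

Lemma p_scale1_odd n (pi : setpart n) : odd_blocks pi -> p_scale 1 pi != 0.
Proof.
by move=> oddP; rewrite p_scale_odd //; apply/prodf_neq0 => B _; rewrite expr1n.
Qed.

Lemma p_scale1_even n (pi : setpart n) : ~~ odd_blocks pi -> p_scale 1 pi = 0.
Proof.
move=> /forallPn[B]; rewrite negb_imply => /andP[BP /negPf eB].
by rewrite /p_scale (bigD1 B) //= expr1n -signr_odd eB subrr mul0r.
Qed.

Lemma Psi1_h n (pi : setpart n) : Psi 1 (h_ pi) =
  \sum_(sg | odd_blocks sg) (forest_count pi sg * p_scale 1 sg) *: p_ sg.
Proof.
rewrite Psi_h [RHS]big_mkcond; apply: eq_bigr => sg _.
by case: ifPn => // /p_scale1_even->; rewrite mulr0 scale0r.
Qed.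

Definition h_family : set ncseries := fun f => exists n (pi : setpart n), f = h_ pi.

Lemma h_in_NCSym n (pi : setpart n) : NCSym (h_ pi).
Proof.
rewrite NCSym_p h_sum_p; apply: (subspace_sum (subspace_lspan _)) => sg _.
by apply: (subspaceZ (subspace_lspan _)); apply: lspan_mem; exists n, sg.
Qed.

Lemma NCSym_h : NCSym = lspan h_family.
Proof.
apply/funext => f; apply/propext; split; last first.
  apply: lspan_min; first exact: subspace_lspan.
  by move=> _ [n [pi ->]]; exact: h_in_NCSym.
rewrite NCSym_p; apply: lspan_min; first exact: subspace_lspan.
move=> _ [n [pi ->]].
apply: (@triangular_span _ predT (@forest_count n) (@npairs n) (@p_ n) (@h_ n)) => //.
- by move=> sg _; exact: forest_count_diag.
- by move=> sg tau _ _; exact: forest_count_tri.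
- by move=> sg _; exact: h_sum_p.
- exact: subspace_lspan.
- by move=> sg _; apply: lspan_mem; exists n, sg.
Qed.

Lemma Psi_NCSym t f : NCSym f -> NCSym (Psi t f).
Proof.
rewrite NCSym_p; apply: (lspan_min (S := fun f => lspan p_family (Psi t f))).
  have [S0 S1] := subspace_lspan p_family; split.
    by rewrite Psi0.
  by move=> a u v hu hv; rewrite Psi_linear; apply: S1.
move=> _ [n [pi ->]]; rewrite Psi_p; apply: (subspaceZ (subspace_lspan _)).
by apply: lspan_mem; exists n, pi.
Qed.

Lemma Psi0_is_omega : is_omega (Psi 0).
Proof.
split=> [a u v _ _|f|f|n pi]; first exact: Psi_linear.
- exact: Psi_NCSym.
- rewrite NCSym_p; apply: (lspan_min (S := fun f => Psi 0 (Psi 0 f) = f)).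
    split; first by rewrite !Psi0.
    by move=> a u v hu hv; rewrite !Psi_linear hu hv.
  by move=> _ [n [pi ->]]; rewrite Psi_p PsiZ Psi_p scalerA p_scale0_sign scale1r.
- by rewrite Psi_h -e_sum_p.
Qed.

(** [Psi 0] shows that the choice defining [omega] is among actual candidates; any candidate has the
    same values on the [h_], which span [NCSym]. *)
Lemma omega_Psi f : NCSym f -> omega f = Psi 0 f.
Proof.
have [linw _ _ wh] : is_omega omega by apply: xgetPex; exists (Psi 0); exact: Psi0_is_omega.
rewrite NCSym_h => hf.
apply: (@linear_on_eq NCSym omega _ linw _ h_family) hf => //.
- exact: subspace_lspan.
- by move=> a u v _ _; exact: Psi_linear.
- by rewrite NCSym_h.
- by move=> _ [n [pi ->]]; rewrite wh Psi_h -e_sum_p.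
Qed.

(** * Theta on symmetric functions *)

Section OrderTypes.
Variable n : nat.
Implicit Types (i : 'I_n -> nat) (u : {ffun 'I_n -> 'I_n}) (j k : 'I_n).

Local Notation letters u := (fun j => nat_of_ord (fun_of_fin u j)).

Definition same_order i i' : bool :=
  [forall j, forall k, (i j < i k)%N == (i' j < i' k)%N].

Lemma same_orderP i i' :
  reflect (forall j k, (i j < i k)%N = (i' j < i' k)%N) (same_order i i').
Proof.
apply: (iffP forallP) => [H j k|H j]; last by apply/forallP => k; rewrite H.
by have /forallP/(_ k)/eqP := H j.
Qed.

(** Quasisymmetry in noncommuting variables: the coefficient depends only on the relative order of
    the letters. *)
Definition order_invariant (phi : ('I_n -> nat) -> rat) :=
  forall i i', same_order i i' -> phi i = phi i'.

(** Replacing letters by their ranks keeps the order type and lands in a finite type, so order types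
    can be summed over. *)
Definition pack i : {ffun 'I_n -> 'I_n} := [ffun j => rank i j].

Definition packed u : bool := pack (letters u) == u.

Lemma same_order_pack i : same_order i (letters (pack i)).
Proof. by apply/same_orderP => j k; rewrite !ffunE rank_lt. Qed.

Lemma pack_same_order i i' : same_order i i' -> pack i = pack i'.
Proof.
move=> /same_orderP ii'; apply/ffunP => j; rewrite !ffunE; apply: ord_inj.
by apply: eq_card => k; rewrite !inE ii'.
Qed.

Lemma packed_pack i : packed (pack i).
Proof. by apply/eqP/esym/pack_same_order/same_order_pack. Qed.

Definition order_series u : ncseries := tuplesum (fun i => (same_order i (letters u))%:R).

Lemma order_series_sum (phi : ('I_n -> nat) -> rat) : order_invariant phi ->
  tuplesum phi = \sum_(u | packed u) phi (letters u) *: order_series u.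
Proof.
move=> inv; rewrite sum_tuplesum; apply: tuplesum_ext => i.
rewrite (bigD1 (pack i)) ?packed_pack //= same_order_pack mulr1.
rewrite big1 ?addr0 => [|u /andP[/eqP pu ne]]; first exact/inv/same_order_pack.
case so : same_order; last by rewrite mulr0.
by rewrite (pack_same_order so) pu eqxx in ne.
Qed.

(** The set composition lists the fibres of u by increasing value; the index of a block is then the
    position of its value among the values taken. *)
Lemma order_series_M u : exists phi : seq {set 'I_n}, is_setcomp phi /\ order_series u = M_ phi.
Proof.
pose s := [seq v <- enum 'I_n | v \in codom u].
pose fib v : {set 'I_n} := [set j | u j == v].
have fib_inj : {in s &, injective fib}.
  move=> v v'; rewrite mem_filter => /andP[/codomP[j ->] _] _ /setP/(_ j).
  by rewrite !inE eqxx => /esym/eqP.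
exists [seq fib v | v <- s]; split.
  rewrite /is_setcomp map_inj_in_uniq // filter_uniq ?enum_uniq //=.
  rewrite (_ : [set B in _] = preim_partition u [set: 'I_n]) ?preim_partitionP //.
  apply/setP => B; rewrite inE; apply/mapP/imsetP => [[v]|[j _ ->]].
    rewrite mem_filter => /andP[/codomP[j ->] _] ->; exists j => //.
    by apply/setP => k; rewrite !inE eq_sym.
  exists (u j); first by rewrite mem_filter codom_f mem_enum.
  by apply/setP => k; rewrite !inE eq_sym.
have biE j : block_index [seq fib v | v <- s] j = index (u j) s.
  rewrite /block_index find_map; apply: eq_find => v.
  by rewrite /= inE eq_sym.
have us j : u j \in s by rewrite mem_filter codom_f mem_enum.
have sorted_s : sorted (fun a b : 'I_n => (a < b)%N) s.
  apply: sorted_filter; first by move=> a b c; apply: ltn_trans.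
  by have := iota_ltn_sorted 0 n; rewrite -val_enum_ord sorted_map.
have lt_index j k : (index (u j) s < index (u k) s)%N = (u j < u k)%N.
  have H a b : a \in s -> b \in s -> (index a s < index b s)%N -> (a < b)%N.
    apply: (@sorted_ltn_index _ (fun a b : 'I_n => (a < b)%N) _ _ sorted_s).
    by move=> x y z; apply: ltn_trans.
  case: (ltngtP (index (u j) s)) => [lt|gt|E].
  - by rewrite H.
  - by apply/esym/negbTE; rewrite -leqNgt ltnW // H.
  - by rewrite -(nth_index (u j) (us j)) E nth_index // ltnn.
apply: tuplesum_ext => i; congr (nat_of_bool _)%:R.
apply/same_orderP/forallP => [H j|H j k].
  apply/forallP => k; rewrite !biE lt_index H eqxx andbT.
  by rewrite !eqn_leq ![(index _ _ <= _)%N]leqNgt ![(i _ <= _)%N]leqNgt !lt_index !H.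
have /forallP/(_ k)/andP[_ /eqP->] := H j.
by rewrite !biE lt_index.
Qed.

Lemma NCQSym_order_invariant (phi : ('I_n -> nat) -> rat) :
  order_invariant phi -> NCQSym (tuplesum phi).
Proof.
move=> inv; rewrite order_series_sum //.
apply: (subspace_sum (subspace_lspan _)) => u _.
apply: (subspaceZ (subspace_lspan _)); apply: lspan_mem.
by have [phi' [? ?]] := order_series_M u; exists n, phi'.
Qed.

Lemma NCQSym_F (A : {set 'I_n}) (s : 'S_n) : NCQSym (F_ A s).
Proof.
apply: NCQSym_order_invariant => i i' /same_orderP ii'.
congr (nat_of_bool _)%:R; rewrite /F_admissible.
by apply: eq_forallb => j; apply: eq_forallb => k; rewrite leqNgt ii' -leqNgt ii'.
Qed.

(* Defines the F function whose leading order type is that of u. *)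
Definition order_refines u i : bool :=
  [forall j, forall k, ((u j < u k)%N ==> (i j < i k)%N) &&
     ((u j == u k) && (j <= k)%N ==> (i j <= i k)%N)].

Lemma order_refinesP u i : reflect
  (forall j k, ((u j < u k)%N -> (i j < i k)%N) /\
               (u j = u k -> (j <= k)%N -> (i j <= i k)%N)) (order_refines u i).
Proof.
apply: (iffP forallP) => [H j k|H j].
  have /forallP/(_ k)/andP[/implyP H1 /implyP H2] := H j; split=> // ujk le_jk.
  by apply: H2; rewrite ujk eqxx.
apply/forallP => k; have [H1 H2] := H j k.
by apply/andP; split; apply/implyP => // /andP[/eqP]; apply: H2.
Qed.

(** The permutation s reads the positions by increasing letter of u, ties from left to right, which
    is the order of u j * n + j. A marks the places where the letter of u jumps; inside a tie s
    increases, so its descents lie in A. *)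
Lemma F_order_refines u : exists (A : {set 'I_n}) (s : 'S_n),
  [/\ A \subset interior_ord n, Des s \subset A &
      F_ A s = tuplesum (fun i => (order_refines u i)%:R)].
Proof.
pose v j := (u j * n + j)%N.
have vinj : injective v.
  move=> j k E; apply: ord_inj; have := congr1 (modn^~ n) E.
  by rewrite !modnMDl !modn_small.
have [g gv] := rank_perm vinj; pose s := g^-1%g.
have sv a b : (v (s a) < v (s b))%N = (a < b)%N by rewrite -gv !permKV.
have v_lt j k : (v j < v k)%N = (u j < u k)%N || (u j == u k) && (j < k)%N.
  rewrite /v -(inj_eq (@ord_inj n)); have [hj hk] := (ltn_ord j, ltn_ord k).
  case: (ltngtP (u j) (u k)) => [lt|gt|->] /=; [nia | nia | by rewrite ltn_add2l].
pose A := [set a : 'I_n | [exists b : 'I_n, (b == a.+1 :> nat) && (u (s a) < u (s b))%N]].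
exists A, s; split.
- apply/subsetP => a; rewrite !inE => /existsP[b /andP[/eqP ba _]].
  by rewrite -ba.
- apply/subsetP => a; rewrite !inE => /existsP[b /andP[/eqP ba lt]].
  apply/existsP; exists b; rewrite ba eqxx /=.
  by have := sv a b; rewrite ba ltnSn v_lt [(s a < s b)%N]ltnNge (ltnW lt) andbF orbF.
apply: tuplesum_ext => i; congr (nat_of_bool _)%:R.
apply/forallP/order_refinesP => [H|H a]; last first.
  apply/forallP => b; apply/implyP => /eqP ba.
  have lt_ab : (a < b)%N by rewrite ba.
  have [H1 H2] := H (s a) (s b).
  have := sv a b; rewrite lt_ab v_lt => /orP[lt_u|/andP[/eqP E lt_s]].
    by rewrite ltnW H1 ?implybT.
  rewrite (H2 E (ltnW lt_s)) /=; apply/implyP; rewrite inE => /existsP[c /andP[/eqP ca]].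
  have -> : c = b by apply: ord_inj; rewrite ca ba.
  by rewrite E ltnn.
(* Admissibility compares neighbours only; induction on the distance m extends it to all pairs. *)
have step (m : nat) (a b : 'I_n) : b = (a + m)%N :> nat ->
  (i (s a) <= i (s b))%N /\ ((u (s a) < u (s b))%N -> (i (s a) < i (s b))%N).
  elim: m b => [|m IHm] b bE.
    by have -> : b = a by [apply: ord_inj; rewrite bE addn0]; rewrite !ltnn.
  have lt_b' : (a + m < n)%N by have := ltn_ord b; lia.
  pose b' := Ordinal lt_b'.
  have [le1 lt1] := IHm b' erefl.
  have /forallP/(_ b)/implyP := H b'.
  rewrite bE addnS eqxx => /(_ isT)/andP[le2 /implyP lt2]; split.
    exact: leq_trans le1 le2.
  move=> lt_u; case: (ltnP (u (s a)) (u (s b'))) => [/lt1 lt|ge].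
    exact: leq_trans lt le2.
  apply: leq_ltn_trans le1 _; apply: lt2; rewrite inE; apply/existsP; exists b.
  by rewrite bE addnS eqxx (leq_ltn_trans ge lt_u).
have all_pairs j k : (v j < v k)%N ->
    (i j <= i k)%N /\ ((u j < u k)%N -> (i j < i k)%N).
  rewrite -gv => lt; have := step (g k - g j)%N (g j) (g k).
  by rewrite subnKC ?(ltnW lt) // /s !permK; apply.
move=> j k; split=> [lt|E le_jk].
  by apply: (all_pairs j k _).2 => //; rewrite v_lt lt.
have [->//|ne] := eqVneq j k; apply: (all_pairs j k _).1.
by rewrite v_lt E ltnn eqxx /= ltn_neqAle le_jk andbT (inj_eq (@ord_inj _)) ne.
Qed.

Definition strict_pairs u : nat := #|[set jk : 'I_n * 'I_n | (u jk.1 < u jk.2)%N]|.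

Definition F_family : set ncseries := fun f => exists n (A : {set 'I_n}) (s : 'S_n),
  [/\ A \subset interior_ord n, Des s \subset A & f = F_ A s].

(** The F attached to u is the sum of the order series of all packed u' refining u. A proper
    refinement has more strict pairs, so the expansion is triangular and can be inverted. *)
Lemma order_invariant_F (phi : ('I_n -> nat) -> rat) :
  order_invariant phi -> lspan F_family (tuplesum phi).
Proof.
move=> inv; rewrite order_series_sum //.
apply: (subspace_sum (subspace_lspan _)) => u pu.
apply: (subspaceZ (subspace_lspan _)).
pose b u := tuplesum (fun i => (order_refines u i)%:R).
apply: (@triangular_span _ packed (fun u u' => (order_refines u (letters u'))%:R)
  (fun u => n * n - strict_pairs u)%N order_series b) pu.
- move=> u' _; rewrite (_ : order_refines u' (letters u')) ?oner_eq0 //.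
  by apply/order_refinesP => j k; split=> // ->.
- move=> u1 u2 /eqP p1 /eqP p2; case ref : order_refines => // _.
  move/order_refinesP: ref => ref.
  have [->|ne] := eqVneq u2 u1; [by left | right].
  have lt : (strict_pairs u1 < strict_pairs u2)%N.
    apply: proper_card; rewrite properEneq; apply/andP; split; last first.
      by apply/subsetP => -[j k]; rewrite !inE; apply: (ref j k).1.
    apply: contraNneq ne => E; rewrite -p1 -p2; apply/eqP/esym/pack_same_order.
    by apply/same_orderP => j k; have /setP/(_ (j, k)) := E; rewrite !inE.
  rewrite ltn_sub2l //; apply: leq_trans lt _.
  by rewrite -[n in leqRHS]card_ord -card_prod max_card.
- move=> u' _; apply: order_series_sum => i i' /same_orderP ii'.
  congr (nat_of_bool _)%:R; rewrite /order_refines.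
  by apply: eq_forallb => j; apply: eq_forallb => k; rewrite ii' [(i j <= i k)%N]leqNgt ii' -leqNgt.
- exact: subspace_lspan.
- move=> u' _; apply: lspan_mem; have [A [s [? ? E]]] := F_order_refines u'.
  by exists n, A, s; rewrite /b -E.
Qed.

End OrderTypes.

Lemma NCSym_F f : NCSym f -> lspan F_family f.
Proof.
rewrite NCSym_p; apply: lspan_min; first exact: subspace_lspan.
move=> _ [n [pi ->]]; rewrite p_E; apply: order_invariant_F => i i' /same_orderP ii'.
congr (nat_of_bool _)%:R; rewrite /finer.
apply: eq_forallb => j; apply: eq_forallb => k; rewrite !same_part_of.
by rewrite !eqn_leq ![(i _ <= _)%N]leqNgt ![(i' _ <= _)%N]leqNgt !ii'.
Qed.

(** [Theta] and [Psi 1] agree on the F, whose span contains [NCSym]. As [Theta] is linear on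
    [NCQSym] only, the F must also be located there. *)
Lemma Theta_Psi f : NCSym f -> Theta f = Psi 1 f.
Proof.
have [linT TF] : is_Theta Theta by apply: xgetPex; exists (Psi 1); exact: Psi_is_Theta.
move/NCSym_F => hf.
apply: (@linear_on_eq NCQSym Theta _ linT _ F_family) hf => //.
- exact: subspace_lspan.
- by move=> a u v _ _; exact: Psi_linear.
- apply: lspan_min; first exact: subspace_lspan.
  by move=> _ [n [A [s [_ _ ->]]]]; exact: NCQSym_F.
- move=> _ [n [A [s [subA desA ->]]]].
  have [_ PF] := Psi_is_Theta.
  by rewrite TF // PF.
Qed.

(** * Concatenation of set partitions and freeness *)

Lemma ncmulDl a u v g : ncmul (a *: u + v) g = a *: ncmul u g + ncmul v g.
Proof.
apply/funext => w; rewrite /ncmul.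
transitivity (a * (\sum_(k < (size w).+1) u (take k w) * g (drop k w)) +
   \sum_(k < (size w).+1) v (take k w) * g (drop k w)); last by [].
rewrite mulr_sumr -big_split; apply: eq_bigr => k _ /=.
by rewrite [(_ + _) (take k w)](_ : _ = a * u (take k w) + v (take k w)) //; ring.
Qed.

Lemma ncmulDr a u v g : ncmul g (a *: u + v) = a *: ncmul g u + ncmul g v.
Proof.
apply/funext => w; rewrite /ncmul.
transitivity (a * (\sum_(k < (size w).+1) g (take k w) * u (drop k w)) +
   \sum_(k < (size w).+1) g (take k w) * v (drop k w)); last by [].
rewrite mulr_sumr -big_split; apply: eq_bigr => k _ /=.
by rewrite [(_ + _) (drop k w)](_ : _ = a * u (drop k w) + v (drop k w)) //; ring.
Qed.

Lemma ncmul0l g : ncmul 0 g = 0.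
Proof. by apply/funext => w; rewrite /ncmul big1 // => k _; rewrite mul0r. Qed.

Lemma ncmul0r g : ncmul g 0 = 0.
Proof. by apply/funext => w; rewrite /ncmul big1 // => k _; rewrite mulr0. Qed.

Lemma lspan_ncmul (X S : set ncseries) : subspace S ->
  (forall f g, X f -> X g -> S (ncmul f g)) ->
  forall f g, lspan X f -> lspan X g -> S (ncmul f g).
Proof.
move=> [S0 S1] XS f g Xf Xg; move: f Xf.
apply: lspan_min; first split.
- by rewrite ncmul0l.
- by move=> a u v Su Sv; rewrite ncmulDl; apply: S1.
move=> f Xf; move: g Xg; apply: lspan_min; first split.
- by rewrite ncmul0r.
- by move=> a u v Su Sv; rewrite ncmulDr; apply: S1.
by move=> g Xg; apply: XS.
Qed.

Lemma ncmul_tuplesum m n (c : ('I_m -> nat) -> rat) (d : ('I_n -> nat) -> rat) :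
  ncmul (tuplesum c) (tuplesum d) =
  tuplesum (fun i => c (fun j => i (lshift n j)) * d (fun j => i (rshift m j))).
Proof.
apply/funext => w; rewrite /ncmul /tuplesum.
case: eqP => [sw|/eqP sw]; last first.
  rewrite big1 // => k _; have := ltn_ord k; rewrite ltnS => lek.
  rewrite size_takel // size_drop; case: eqP => [km|]; last by rewrite mul0r.
  by case: eqP => [kn|]; [move: sw; lia | rewrite mulr0].
have ltm : (m < (size w).+1)%N by lia.
rewrite (bigD1 (Ordinal ltm)) //= big1 ?addr0 => [|k km]; last first.
  have := ltn_ord k; rewrite ltnS => lek.
  rewrite size_takel //; case: eqP => [ekm|]; last by rewrite mul0r.
  by case/eqP: km; apply: ord_inj.
rewrite size_takel; last by lia.
rewrite size_drop sw addKn !eqxx; congr (c _ * d _); apply/funext => j.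
  by rewrite nth_take.
by rewrite nth_drop.
Qed.

Section Concatenation.
Variables (m n : nat) (a : setpart m) (b : setpart n).

Definition catp : setpart (m + n) := part_of (fun j =>
  match split j with
  | inl x => inl (pblock (val a) x) | inr y => inr (pblock (val b) y)
  end).

Let split_l j : split (lshift n j) = inl j :> 'I_m + 'I_n.
Proof. exact: (unsplitK (inl j)). Qed.

Let split_r j : split (rshift m j) = inr j :> 'I_m + 'I_n.
Proof. exact: (unsplitK (inr j)). Qed.

Lemma catp_ll j k : same_block catp (lshift n j) (lshift n k) = same_block a j k.
Proof. by rewrite same_part_of !split_l same_blockE. Qed.

Lemma catp_rr j k : same_block catp (rshift m j) (rshift m k) = same_block b j k.
Proof. by rewrite same_part_of !split_r same_blockE. Qed.

Lemma catp_lr j k : same_block catp (lshift n j) (rshift m k) = false.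
Proof. by rewrite same_part_of split_l split_r. Qed.

Lemma catp_rl j k : same_block catp (rshift m j) (lshift n k) = false.
Proof. by rewrite same_part_of split_l split_r. Qed.

Lemma finer_catp (T : eqType) (i : 'I_(m + n) -> T) : finer catp (part_of i) =
  finer a (part_of (fun j => i (lshift n j))) &&
  finer b (part_of (fun j => i (rshift m j))).
Proof.
apply/finerP/andP => [H|[/finerP Ha /finerP Hb] j k].
  split; apply/finerP => j k jk; rewrite same_part_of.
    by have := H (lshift n j) (lshift n k); rewrite catp_ll same_part_of; apply.
  by have := H (rshift m j) (rshift m k); rewrite catp_rr same_part_of; apply.
rewrite same_part_of; case: (splitP j) => j' jE; case: (splitP k) => k' kE.
- have -> : j = lshift n j' by apply: ord_inj.
  have -> : k = lshift n k' by apply: ord_inj.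
  by rewrite catp_ll => /Ha; rewrite same_part_of.
- have -> : j = lshift n j' by apply: ord_inj.
  have -> : k = rshift m k' by apply: ord_inj.
  by rewrite catp_lr.
- have -> : j = rshift m j' by apply: ord_inj.
  have -> : k = lshift n k' by apply: ord_inj.
  by rewrite catp_rl.
- have -> : j = rshift m j' by apply: ord_inj.
  have -> : k = rshift m k' by apply: ord_inj.
  by rewrite catp_rr => /Hb; rewrite same_part_of.
Qed.

Lemma p_catp : p_ catp = ncmul (p_ a) (p_ b).
Proof.
rewrite !p_E ncmul_tuplesum; apply: tuplesum_ext => i.
by rewrite finer_catp -natrM mulnb.
Qed.

(** In the form [h_E] there is one factor per position, and the partners of a position lie on its
    own side of the cut. *)
Lemma h_catp : h_ catp = ncmul (h_ a) (h_ b).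
Proof.
rewrite !h_E ncmul_tuplesum; apply: tuplesum_ext => i.
rewrite big_split_ord /=; congr (_ * _); apply: eq_bigr => j _;
  rewrite big_split_ord /=.
  rewrite [X in _ + X]big1 ?addr0 => [|k _]; last by rewrite catp_lr andbF.
  by apply: eq_bigr => k _; rewrite catp_ll.
rewrite [X in X + _]big1 ?add0r => [|k _]; last by rewrite catp_rl andbF.
by apply: eq_bigr => k _; rewrite catp_rr leq_add2l.
Qed.

Lemma pblock_catp_l j : pblock (val catp) (lshift n j) = lshift n @: pblock (val a) j.
Proof.
apply/setP => k; rewrite -[LHS]/(same_block catp _ k).
case: (splitP k) => k' kE.
  have -> : k = lshift n k' by apply: ord_inj.
  by rewrite catp_ll mem_imset //; exact: lshift_inj.
have -> : k = rshift m k' by apply: ord_inj.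
rewrite catp_lr; apply/esym/negbTE/imsetP => -[l _ /(congr1 val) /=].
by have := ltn_ord l; lia.
Qed.

Lemma pblock_catp_r j : pblock (val catp) (rshift m j) = @rshift m n @: pblock (val b) j.
Proof.
apply/setP => k; rewrite -[LHS]/(same_block catp _ k).
case: (splitP k) => k' kE; last first.
  have -> : k = rshift m k' by apply: ord_inj.
  by rewrite catp_rr mem_imset //; exact: rshift_inj.
have -> : k = lshift n k' by apply: ord_inj.
rewrite catp_rl; apply/esym/negbTE/imsetP => -[l _ /(congr1 val) /=].
by have := ltn_ord k'; lia.
Qed.

Lemma val_catp : val catp =
  [set lshift n @: (B : {set 'I_m}) | B in val a] :|:
  [set @rshift m n @: (B : {set 'I_n}) | B in val b].
Proof.
rewrite [LHS]val_setpart; apply/setP => B; rewrite inE; apply/imsetP/orP => [[k _ ->]|].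
  case: (splitP k) => k' kE; [left | right].
    have -> : k = lshift n k' by apply: ord_inj.
    by rewrite pblock_catp_l imset_f // pblock_setpart.
  have -> : k = rshift m k' by apply: ord_inj.
  by rewrite pblock_catp_r; apply/imsetP; exists (pblock (val b) k'); rewrite ?pblock_setpart.
case=> /imsetP[_ /setpart_block[j ->] ->].
  by exists (lshift n j); rewrite ?pblock_catp_l.
by exists (rshift m j); rewrite ?pblock_catp_r.
Qed.

Lemma prod_catp (G : nat -> rat) : \prod_(B in val catp) G #|B| =
  (\prod_(B in val a) G #|B|) * \prod_(B in val b) G #|B|.
Proof.
rewrite val_catp; set X := imset _ _; set Y := imset _ _.
rewrite (eq_bigl [predU X & Y]) => [|B]; last by rewrite !inE.
rewrite bigU /=; last first.
  rewrite disjoints_subset; apply/subsetP => _ /imsetP[_ /setpart_block[j ->] ->].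
  rewrite inE; apply/imsetP => -[B _ /setP/(_ (lshift n j))].
  rewrite imset_f ?mem_pblock ?mem_cover_setpart // => /esym/imsetP[l _ /(congr1 val) /=].
  by have := ltn_ord j; lia.
rewrite big_imset /=; last by move=> B C _ _; apply: imset_inj; exact: lshift_inj.
rewrite [X in _ * X]big_imset /=; last by move=> B C _ _; apply: imset_inj; exact: rshift_inj.
congr (_ * _); apply: eq_bigr => B _; rewrite card_imset //.
  exact: lshift_inj.
exact: rshift_inj.
Qed.

Lemma p_scale_catp t : p_scale t catp = p_scale t a * p_scale t b.
Proof. exact: (prod_catp (fun k => t ^+ k - (-1) ^+ k)). Qed.

Lemma odd_catp : odd_blocks catp = odd_blocks a && odd_blocks b.
Proof.
apply/forall_inP/andP => [H|[/forall_inP Ha /forall_inP Hb] B].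
  split; apply/forall_inP => B BP.
    rewrite -(card_imset B (@lshift_inj m n)); apply: H.
    by rewrite val_catp inE imset_f.
  rewrite -(card_imset B (@rshift_inj m n)); apply: H.
  by rewrite val_catp inE; apply/orP; right; apply/imsetP; exists B.
rewrite val_catp inE => /orP[] /imsetP[C CP ->].
  by rewrite card_imset ?Ha //; exact: lshift_inj.
by rewrite card_imset ?Hb //; exact: rshift_inj.
Qed.

End Concatenation.

(** On power sums [Psi t] is diagonal, with a scalar that is multiplicative under concatenation;
    bilinearity does the rest. This carries multiplicativity from [h_] to [q_]. *)
Lemma Psi_ncmul t f g : NCSym f -> NCSym g ->
  Psi t (ncmul f g) = ncmul (Psi t f) (Psi t g).
Proof.
rewrite NCSym_p => hf hg; move: f hf.
apply: (lspan_min (S := fun f => Psi t (ncmul f g) = ncmul (Psi t f) (Psi t g))).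
  split; first by rewrite Psi0 !ncmul0l Psi0.
  by move=> a u v hu hv; rewrite ncmulDl !Psi_linear ncmulDl hu hv.
move=> _ [m [a ->]]; move: g hg.
apply: (lspan_min (S := fun g => Psi t (ncmul (p_ a) g) = ncmul (Psi t (p_ a)) (Psi t g))).
  split; first by rewrite Psi0 !ncmul0r Psi0.
  by move=> c u v hu hv; rewrite ncmulDr !Psi_linear ncmulDr hu hv.
move=> _ [n [b ->]]; rewrite -p_catp !Psi_p p_catp p_scale_catp.
rewrite -[p_scale t a *: _]addr0 ncmulDl ncmul0l addr0.
by rewrite -[p_scale t b *: _]addr0 ncmulDr ncmul0r addr0 scalerA.
Qed.

Lemma q_catp m n (a : setpart m) (b : setpart n) :
  q_ (catp a b) = ncmul (q_ a) (q_ b).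
Proof.
rewrite /q_ !Theta_Psi; try exact: h_in_NCSym.
by rewrite h_catp; apply: Psi_ncmul; exact: h_in_NCSym.
Qed.

(** * Unique factorization into connected set partitions *)

Definition catx (x y : anypart) : anypart :=
  Tagged setpart (catp (tagged x) (tagged y)).

Definition emptyx : anypart := Tagged setpart (part_of (fun _ : 'I_0 => 0%N)).

(** Indexing by plain numbers allows partitions of different ground sets to be compared without
    casts between ordinal types. *)
Definition samex (x : anypart) (j k : nat) : bool :=
  if insub j is Some j' then
    if insub k is Some k' then same_block (tagged x) j' k' else false
  else false.

Lemma samex_ord n (pi : setpart n) (j k : 'I_n) :
  samex (Tagged setpart pi) j k = same_block pi j k.
Proof. by rewrite /samex /= !valK. Qed.

Lemma samex_ext x y : tag x = tag y ->
  (forall j k, (j < tag x)%N -> (k < tag x)%N -> samex x j k = samex y j k) -> x = y.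
Proof.
case: x y => [m a] [n b] /= E; subst n => H; congr existT.
by apply: setpart_ext => j k; rewrite -!samex_ord; apply: H.
Qed.

Lemma samex_catl x y j k : (j < tag x)%N -> (k < tag x)%N ->
  samex (catx x y) j k = samex x j k.
Proof.
case: x => m a /= hj hk; rewrite -[j]/(val (lshift (tag y) (Ordinal hj))).
rewrite -[k]/(val (lshift (tag y) (Ordinal hk))) samex_ord catp_ll.
exact/esym/(samex_ord a (Ordinal hj) (Ordinal hk)).
Qed.

Lemma samex_catr x y j k : (j < tag y)%N -> (k < tag y)%N ->
  samex (catx x y) (tag x + j) (tag x + k) = samex y j k.
Proof.
case: y => n b /= hj hk; rewrite -[(_ + j)%N]/(val (rshift (tag x) (Ordinal hj))).
rewrite -[(_ + k)%N]/(val (rshift (tag x) (Ordinal hk))) samex_ord catp_rr.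
exact/esym/(samex_ord b (Ordinal hj) (Ordinal hk)).
Qed.

Lemma samex_catlr x y j k : (j < tag x)%N -> (tag x <= k)%N -> (k < tag x + tag y)%N ->
  samex (catx x y) j k = false.
Proof.
move=> hj hk hk'; have lt : (k - tag x < tag y)%N by lia.
have jE : j = lshift (tag y) (Ordinal hj) :> nat by [].
have kE : k = rshift (tag x) (Ordinal lt) :> nat by rewrite /= subnKC.
by rewrite jE kE samex_ord catp_lr.
Qed.

Lemma connected_cross n (pi : setpart n) m : connected pi -> (0 < m < n)%N ->
  exists j k, [/\ (j < m)%N, (m <= k)%N, (k < n)%N & samex (Tagged setpart pi) j k].
Proof.
case/andP=> _ /forallP H /andP[m0 mn].
have /implyP/(_ m0) := H (Ordinal mn).
move=> /forall_inPn[B BP]; rewrite negb_or => /andP[/subsetPn[k kB km] /subsetPn[j jB jm]].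
rewrite !inE /= -?leqNgt -?ltnNge in km jm.
exists j, k; rewrite samex_ord same_blockE.
split=> //; have -> : pblock (val pi) j = B by apply/eqP; rewrite pblock_eq.
by rewrite eq_sym pblock_eq.
Qed.

Lemma connected_pos (x : anypart) : connected (tagged x) -> (0 < tag x)%N.
Proof. by case/andP. Qed.

Lemma connected_not_prefix x y x' y' : (0 < tag x < tag x')%N ->
  connected (tagged x') -> catx x y <> catx x' y'.
Proof.
case: x' => n' pi' /= lt cx' E.
have [j [k [hj hk hk' jk]]] := connected_cross cx' lt.
have tE : (tag x + tag y = n' + tag y')%N := congr1 tag E.
have k_lt : (k < tag x + tag y)%N by lia.
have := samex_catlr (x := x) (y := y) hj hk k_lt.
by rewrite E samex_catl ?jk //=; case/andP: lt => _; apply: ltn_trans.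
Qed.

(** If the first factors had different sizes, the end of the shorter one would be a cut of the
    common partition, while a block of the longer, connected one crosses it. Equal sizes determine
    both factors. *)
Lemma catx_inj x y x' y' : connected (tagged x) -> connected (tagged x') ->
  catx x y = catx x' y' -> x = x' /\ y = y'.
Proof.
move=> cx cx' E; have tE := congr1 tag E; rewrite /= in tE.
case: (ltngtP (tag x) (tag x')) => [lt|gt|Ex].
- have := @connected_not_prefix x y x' y'; rewrite lt connected_pos //.
  by move=> /(_ isT cx') [].
- have := @connected_not_prefix x' y' x y; rewrite gt connected_pos //.
  by move=> /(_ isT cx) [].
have Ey : tag y = tag y' by lia.
split; apply: samex_ext => // j k hj hk.
  by rewrite -(samex_catl y) // E samex_catl -?Ex.
by rewrite -(samex_catr x) // E Ex samex_catr // -Ey.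
Qed.

Definition catl (l : seq anypart) : anypart := foldr catx emptyx l.

Lemma catl_inj l l' : all (fun x => connected (tagged x)) l ->
  all (fun x => connected (tagged x)) l' -> catl l = catl l' -> l = l'.
Proof.
elim: l l' => [|x l IHl] [|x' l'] //=.
- move=> _ /andP[cx' _] /(congr1 tag) /= E.
  by have := connected_pos cx'; lia.
- move=> /andP[cx _] _ /(congr1 tag) /= E.
  by have := connected_pos cx; lia.
move=> /andP[cx cl] /andP[cx' cl'] /(catx_inj cx cx')[-> E].
by rewrite (IHl l').
Qed.

Lemma split_partition m k (pi : setpart (m + k)) :
  (forall (j : 'I_m) (l : 'I_k), same_block pi (lshift k j) (rshift m l) = false) ->
  exists a b, pi = catp a b.
Proof.
move=> nocross.
exists (part_of (fun j => pblock (val pi) (lshift k j))).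
exists (part_of (fun j => pblock (val pi) (rshift m j))).
apply: setpart_ext => j l.
case: (splitP j) => j' jE; case: (splitP l) => l' lE.
- have -> : j = lshift k j' by apply: ord_inj.
  have -> : l = lshift k l' by apply: ord_inj.
  by rewrite catp_ll same_part_of same_blockE.
- have -> : j = lshift k j' by apply: ord_inj.
  have -> : l = rshift m l' by apply: ord_inj.
  by rewrite catp_lr nocross.
- have -> : j = rshift m j' by apply: ord_inj.
  have -> : l = lshift k l' by apply: ord_inj.
  by rewrite catp_rl same_blockE eq_sym -same_blockE nocross.
- have -> : j = rshift m j' by apply: ord_inj.
  have -> : l = rshift m l' by apply: ord_inj.
  by rewrite catp_rr same_part_of same_blockE.
Qed.

Lemma not_connected_split x : (0 < tag x)%N -> ~~ connected (tagged x) ->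
  exists y z, [/\ (tag y < tag x)%N, (tag z < tag x)%N & x = catx y z].
Proof.
case: x => n pi /= n0; rewrite /connected n0 /= => /forallPn[m].
rewrite negb_imply negbK => /andP[m0 /forall_inP sep].
have [k nE] : exists k, n = (m + k)%N by exists (n - m)%N; rewrite subnKC // ltnW.
have mn := ltn_ord m; move: (nat_of_ord m) m0 sep nE mn => {m} m m0 sep nE mn.
subst n.
have [j l|a [b ->]] := @split_partition m k pi.
  apply/negbTE/negP => jl; have := sep _ (pblock_setpart pi (lshift k j)).
  case/orP=> /subsetP sub.
    have := sub (rshift m l) jl; rewrite inE /=; lia.
  have := sub (lshift k j); rewrite mem_pblock mem_cover_setpart inE /= => /(_ isT).
  by have := ltn_ord j; lia.
exists (Tagged setpart a), (Tagged setpart b); split => //=; lia.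
Qed.

(** * Freeness of multiplicative families *)

Definition oddx (x : anypart) : bool := odd_blocks (tagged x).
Definition conn_oddx (x : anypart) : bool := connected (tagged x) && odd_blocks (tagged x).
Definition px (x : anypart) : ncseries := p_ (tagged x).
Definition qx (x : anypart) : ncseries := q_ (tagged x).

Lemma subalgebra_alg_gen X : subalgebra (alg_gen X).
Proof.
split=> [|S [[_ S1 _] _] //|u v hu hv S SX].
  split=> [S [[[S0 _] _ _] _] //|a u v hu hv S SX].
  by case: (SX) => -[[_ S1] _ _] _; apply: S1; [exact: hu | exact: hv].
by case: (SX) => -[_ _ SM] _; apply: SM; [exact: hu | exact: hv].
Qed.

Lemma odd_emptyx : oddx emptyx.
Proof. by apply/forall_inP => B /setpart_block[[]]. Qed.

Lemma oddx_catl l : all conn_oddx l -> oddx (catl l).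
Proof.
elim: l => [_|x l IHl]; first exact: odd_emptyx.
by move=> /= /andP[/andP[_ ox] /IHl ol]; rewrite /oddx odd_catp ox.
Qed.

Section Freeness.
Variable b : anypart -> ncseries.
Hypothesis b_empty : b emptyx = ncone.
Hypothesis b_catx : forall x y, b (catx x y) = ncmul (b x) (b y).
Let odd_family : set ncseries := fun f => exists2 x, oddx x & b x = f.
Hypothesis b_indep : lin_indep oddx b.
Hypothesis b_span : NCOmega = lspan odd_family.

Lemma ncmonomial_catl l : ncmonomial b l = b (catl l).
Proof. by elim: l => //= x l ->; rewrite b_catx. Qed.

(** Each monomial is b of a concatenation with odd blocks, and distinct lists of connected
    partitions have distinct concatenations, so a relation among monomials is one among the b x. *)
Lemma indep_monomials : lin_indep (all conn_oddx) (ncmonomial b).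
Proof.
move=> s c us /allP Ds; under eq_bigr do rewrite ncmonomial_catl.
move=> E l ls.
have inj : {in s &, injective catl}.
  have Dc l' : l' \in s -> all (fun x => connected (tagged x)) l'.
    by move/Ds/allP => Dl; apply/allP => x /Dl/andP[].
  by move=> l1 l2 /Dc h1 /Dc h2; exact: catl_inj.
pose c' x := c (nth [::] s (index x (map catl s))).
have c'E l' : l' \in s -> c' (catl l') = c l'.
  move=> l's; rewrite /c'; congr c.
  have lt : (index (catl l') (map catl s) < size s)%N.
    by rewrite -(size_map catl) index_mem map_f.
  by apply: inj => //; [exact: mem_nth | rewrite -(nth_map _ emptyx) // nth_index // map_f].
rewrite -c'E //; apply: (b_indep (s := map catl s)); last exact: map_f.
- by rewrite map_inj_in_uniq.
- by apply/allP => _ /mapP[l' /Ds Dl ->]; exact: oddx_catl.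
by rewrite big_map -[RHS]E; apply: eq_big_seq => l' l's; rewrite c'E.
Qed.

(** Partitions that are not connected split into smaller ones, and odd blocks stay odd in the
    factors; induction on the size reaches the generators. *)
Lemma alg_gen_conn_odd :
  NCOmega = alg_gen (fun f => exists2 x, conn_oddx x & b x = f).
Proof.
have [subS S1 SM] := subalgebra_alg_gen (fun f => exists2 x, conn_oddx x & b x = f).
rewrite b_span; apply/funext => f; apply/propext; split.
  apply: lspan_min => // _ [x ox <-].
  have [m] := ubnP (tag x); elim: m x ox => // m IHm x ox; rewrite ltnS => le_m.
  have [x0|x0] := posnP (tag x).
    have -> : x = emptyx by apply: samex_ext => // j k; rewrite x0.
    by rewrite b_empty.
  have [cx|ncx] := boolP (connected (tagged x)).
    by move=> S [_]; apply; exists x => //; rewrite /conn_oddx cx.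
  have [y [z [lty ltz E]]] := not_connected_split x0 ncx.
  move: ox; rewrite E /oddx odd_catp => /andP[oy oz].
  by rewrite b_catx; apply: SM; apply: IHm => //;
    [exact: leq_trans lty le_m | exact: leq_trans ltz le_m].
move=> H; apply: H; split; last first.
  by move=> _ [x /andP[_ ox] <-]; apply: lspan_mem; exists x.
split; first exact: subspace_lspan.
  by rewrite -b_empty; apply: lspan_mem; exists emptyx => //; exact: odd_emptyx.
apply: lspan_ncmul; first exact: subspace_lspan.
move=> _ _ [x ox <-] [y oy <-]; rewrite -b_catx; apply: lspan_mem.
by exists (catx x y) => //; rewrite /oddx odd_catp; apply/andP.
Qed.

End Freeness.

Lemma px_catx x y : px (catx x y) = ncmul (px x) (px y).
Proof. exact: p_catp. Qed.

Lemma qx_catx x y : qx (catx x y) = ncmul (qx x) (qx y).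
Proof. exact: q_catp. Qed.

Lemma p_empty (pi : setpart 0) : p_ pi = ncone.
Proof.
rewrite p_E; apply/funext => w; rewrite /tuplesum /ncone -size_eq0.
by case: eqP => // _; rewrite (_ : finer _ _ = true) //; apply/finerP => -[].
Qed.

Lemma q_E n (pi : setpart n) : q_ pi =
  \sum_(sg | odd_blocks sg) (forest_count pi sg * p_scale 1 sg) *: p_ sg.
Proof. by rewrite /q_ Theta_Psi ?Psi1_h //; exact: h_in_NCSym. Qed.

Lemma q_diag n (pi : setpart n) : odd_blocks pi ->
  forest_count pi pi * p_scale 1 pi != 0.
Proof. by move=> op; rewrite mulf_neq0 ?forest_count_diag ?p_scale1_odd. Qed.

Lemma q_tri n (pi sg : setpart n) : forest_count pi sg * p_scale 1 sg != 0 ->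
  sg = pi \/ (npairs sg < npairs pi)%N.
Proof. by rewrite mulf_eq0 negb_or => /andP[/forest_count_tri]. Qed.

Lemma q_empty : qx emptyx = ncone.
Proof.
pose pi : setpart 0 := part_of (fun _ : 'I_0 => 0%N).
have hE : h_ pi = ncone.
  rewrite h_E; apply/funext => w; rewrite /tuplesum /ncone -size_eq0.
  by case: eqP => // _; rewrite big_ord0.
rewrite /qx /q_ Theta_Psi /=; last exact: h_in_NCSym.
rewrite -/pi hE -(p_empty pi) Psi_p p_scale_odd; last exact: odd_emptyx.
rewrite big1 => [|B BP]; first by rewrite scale1r.
by have [[]] := setpart_block BP.
Qed.

Lemma indep_sub (I : finType) (D : pred I) (f : I -> ncseries) :
  independent_on predT f -> independent_on D f.
Proof.
move=> indf c E i Di; pose c' i := if D i then c i else 0.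
suff /indf/(_ i isT) : \sum_(i | predT i) c' i *: f i = 0 by rewrite /c' Di.
rewrite -[RHS]E [RHS]big_mkcond; apply: eq_bigr => j _.
by rewrite /c'; case: ifP => // _; rewrite scale0r.
Qed.

Lemma px_indep : lin_indep oddx px.
Proof.
apply: lin_indep_graded => [[n pi] w ne|n]; first by rewrite /px p_E tuplesum_homog.
exact/indep_sub/p_indep.
Qed.

Lemma qx_indep : lin_indep oddx qx.
Proof.
apply: lin_indep_graded => [[n pi] w ne|n].
  rewrite /qx q_E; under eq_bigr do rewrite p_E.
  by rewrite sum_tuplesum tuplesum_homog.
apply: (@triangular_indep _ (@odd_blocks n)
  (fun pi sg => forest_count pi sg * p_scale 1 sg) (@npairs n) (@p_ n)).
- by move=> pi; exact: q_diag.
- by move=> pi sg _ _; exact: q_tri.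
- by move=> pi _; exact: q_E.
- exact/indep_sub/p_indep.
Qed.

Lemma NCOmega_px : NCOmega = lspan (fun f => exists2 x, oddx x & px x = f).
Proof.
have [S0 S1] := subspace_lspan (fun f => exists2 x, oddx x & px x = f).
apply/funext => f; apply/propext; split.
  case=> g hg <-; rewrite Theta_Psi //; move: hg; rewrite NCSym_p; move: g.
  apply: (lspan_min (S := fun g => lspan _ (Psi 1 g))).
    split; first by rewrite Psi0.
    by move=> a u v hu hv; rewrite Psi_linear; apply: S1.
  move=> _ [n [pi ->]]; rewrite Psi_p.
  have [op|/p_scale1_even->] := boolP (odd_blocks pi); last by rewrite scale0r.
  apply: (subspaceZ (subspace_lspan _)); apply: lspan_mem.
  by exists (Tagged setpart pi).
have linS : subspace NCOmega.
  have sN : subspace NCSym by exact: subspace_lspan.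
  split.
    exists 0; first by case: sN.
    by rewrite Theta_Psi ?Psi0 //; case: sN.
  move=> a _ _ [u hu <-] [v hv <-]; exists (a *: u + v); first by case: sN => _; apply.
  by rewrite !Theta_Psi ?Psi_linear //; case: sN => _; apply.
apply: lspan_min => // _ [[n pi] op <-].
(* The preimage of [p_ pi] is [p_ pi] divided by its scalar under [Psi 1], which is nonzero because
   all blocks are odd. *)
have pN : NCSym ((p_scale 1 pi)^-1 *: p_ pi).
  rewrite NCSym_p; apply: (subspaceZ (subspace_lspan _)); apply: lspan_mem.
  by exists n, pi.
exists ((p_scale 1 pi)^-1 *: p_ pi) => //.
by rewrite Theta_Psi // PsiZ Psi_p scalerA mulVf ?scale1r //; exact: p_scale1_odd.
Qed.

Lemma NCOmega_qx : NCOmega = lspan (fun f => exists2 x, oddx x & qx x = f).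
Proof.
apply/funext => f; apply/propext; split.
  rewrite NCOmega_px; apply: lspan_min; first exact: subspace_lspan.
  move=> _ [[n pi] op <-].
  apply: (@triangular_span _ (@odd_blocks n)
    (fun pi sg => forest_count pi sg * p_scale 1 sg) (@npairs n) (@p_ n) (@q_ n)) op.
  - by move=> sg; exact: q_diag.
  - by move=> sg tau _ _; exact: q_tri.
  - by move=> sg _; exact: q_E.
  - exact: subspace_lspan.
  - by move=> sg os; apply: lspan_mem; exists (Tagged setpart sg).
rewrite [NCOmega]NCOmega_px; apply: lspan_min; first exact: subspace_lspan.
move=> _ [[n pi] op <-]; rewrite /qx q_E.
apply: (subspace_sum (subspace_lspan _)) => sg os.
apply: (subspaceZ (subspace_lspan _)); apply: lspan_mem.
by exists (Tagged setpart sg).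
Qed.

Lemma omega_q n (pi : setpart n) : omega (q_ pi) = q_ pi.
Proof.
rewrite omega_Psi; last first.
  by rewrite /q_ Theta_Psi; [apply: Psi_NCSym|]; exact: h_in_NCSym.
rewrite q_E Psi_sum; apply: eq_bigr => sg os.
by rewrite PsiZ Psi_p p_scale0_odd // scale1r.
Qed.

Theorem theorem10p7 :
  (forall (n : nat) (pi : setpart n), omega (q_ pi) = q_ pi)
  /\ linear_basis (fun x : anypart => odd_blocks (tagged x))
       (fun x : anypart => q_ (tagged x)) NCOmega
  /\ freely_generates
       (fun x : anypart => connected (tagged x) && odd_blocks (tagged x))
       (fun x : anypart => p_ (tagged x)) NCOmega
  /\ freely_generates
       (fun x : anypart => connected (tagged x) && odd_blocks (tagged x))
       (fun x : anypart => q_ (tagged x)) NCOmega.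
Proof.
split; first exact: omega_q.
split; first by split; [exact: qx_indep | exact: NCOmega_qx].
split; split.
- exact: (alg_gen_conn_odd (p_empty _) px_catx NCOmega_px).
- exact: (indep_monomials (p_empty _) px_catx px_indep).
- exact: (alg_gen_conn_odd q_empty qx_catx NCOmega_qx).
- exact: (indep_monomials q_empty qx_catx qx_indep).
Qed.
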